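(* \textsc{Tournament Value Maximization} restricted to instances with a win-count oriented game-value function can be solved in $n^{\mathcal{O}(\log n)}$ time, where $n=|N|$.
   Context: Players form a finite set $N\subset\mathbb{N}$ with $|N|=n=2^{n'}$ for some $n'\in\mathbb{N}$; player $i$ beats player $j$ whenever $i>j$. A seeding is a bijection $\sigma:N\to[n]$. The knockout tournament under $\sigma$ proceeds in rounds $r=1,\dots,n'$: for each block of seed positions $\{(k-1)2^r+1,\dots,k2^r\}$, the winner of the block is the stronger of the winners of its first half $\{(k-1)2^r+1,\dots,(k-1)2^r+2^{r-1}\}$ and its second half (a single-position block is won by the player seeded there); in round $r$ the winner $a$ of the first half plays the winner $b$ of the second half, and this game has value $v(a,b,r)$, where $v:N\times N\times\mathbb{N}\to\mathbb{Z}$ is the game-value function. The tournament value $V_\sigma$ is the sum of the values of all $n-1$ games played. \textsc{Tournament Value Maximization}: given $N$, $v$ and an integer $V$, decide whether there is a seeding $\sigma$ with $V_\sigma\ge V$. A game-value function $v$ is win-count oriented if there is a player evaluation function $p:N\times\mathbb{N}\to\mathbb{Z}$ such that for every seeding $\sigma$, $V_\sigma=\sum_{i\in N}p(i,w_\sigma(i))$, where $w_\sigma(i)$ is the number of games won by player $i$ under $\sigma$. *)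

(* Defs.v *)
From mathcomp Require Import all_boot all_order all_algebra.
Set Implicit Arguments. Unset Strict Implicit. Unset Printing Implicit Defensive.
Import Order.TTheory GRing.Theory Num.Theory.
Local Open Scope ring_scope.

(* The player set N is given as the strictly increasing list [s] of its *)
(* elements (player i beats j iff i > j).  A seeding sigma : N -> [n] is *)
(* represented by the list [t] of players in seed order (t`_(k-1) is the *)
(* player with seed k); seedings are exactly the lists [t] with         *)
(* [perm_eq t s].  The game-value function is v : nat -> nat -> nat ->  *)
(* int (only its values on N x N x {1..n'} matter).                      *)

(* [tourn v r t] for a block [t] of 2^r consecutive seed positions     *)
(* returns (winner of the block, total value of the games played in the *)
(* block).  The round-r game is played between the winner a of the      *)
(* first half and the winner b of the second half, with value v a b r.  *)
Fixpoint tourn (v : nat -> nat -> nat -> int) (r : nat) (t : seq nat)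
  : nat * int :=
  match r with
  | 0 => (head 0%N t, 0)
  | r'.+1 =>
      let a := tourn v r' (take (2 ^ r') t) in
      let b := tourn v r' (drop (2 ^ r') t) in
      (maxn a.1 b.1, a.2 + b.2 + v a.1 b.1 r'.+1)
  end.

Definition tval (v : nat -> nat -> nat -> int) (n' : nat) (t : seq nat) : int :=
  (tourn v n' t).2.

(* Number of games won by player i in the block t of size 2^r
   (independent of v; we use the zero value function to get winners). *)
Fixpoint wins (r : nat) (t : seq nat) (i : nat) : nat :=
  match r with
  | 0 => 0
  | r'.+1 =>
      wins r' (take (2 ^ r') t) i + wins r' (drop (2 ^ r') t) i
      + (i == (tourn (fun _ _ _ => 0) r'.+1 t).1)
  end.

Definition win_count_oriented (n' : nat) (s : seq nat)
    (v : nat -> nat -> nat -> int) : Prop :=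
  exists p : nat -> nat -> int,
    forall t : seq nat, perm_eq t s ->
      tval v n' t = \sum_(i <- s) p i (wins n' t i).

Definition TVM_yes (n' : nat) (s : seq nat) (v : nat -> nat -> nat -> int)
    (V : int) : Prop :=
  exists t : seq nat, perm_eq t s /\ V <= tval v n' t.

(* Machine model: a unit-cost RAM with unbounded integer cells,         *)
(* addition, subtraction, comparison and indirect addressing (no        *)
(* multiplication).  Memory is int -> int; programs are fixed finite    *)
(* instruction lists; each executed instruction costs one step.         *)
Inductive instr : Type :=
  | ISet of int & int
  | IAdd of int & int & int
  | ISub of int & int & int
  | ILoad of int & int
  | IStore of int & int
  | IJle of int & int & nat
  | IHalt.

Definition program := seq instr.

Record config := Config { cpc : nat; cmem : int -> int }.

Definition upd (m : int -> int) (a x : int) : int -> int :=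
  fun y => if y == a then x else m y.

Definition halted (P : program) (c : config) : bool :=
  if nth IHalt P (cpc c) is IHalt then true else false.

Definition step (P : program) (c : config) : config :=
  let m := cmem c in
  let k := cpc c in
  match nth IHalt P k with
  | ISet i x => Config k.+1 (upd m i x)
  | IAdd i j l => Config k.+1 (upd m i (m j + m l))
  | ISub i j l => Config k.+1 (upd m i (m j - m l))
  | ILoad i j => Config k.+1 (upd m i (m (m j)))
  | IStore i j => Config k.+1 (upd m (m i) (m j))
  | IJle j l tgt => if m j <= m l then Config tgt m else Config k.+1 m
  | IHalt => c
  end.

(* Configuration after k steps (halted configurations are fixed points). *)
Definition exec (P : program) (k : nat) (c : config) : config :=
  iter k (step P) c.

(* Input encoding: cell 0 holds n, cells 1..n hold the players in
   increasing order, then the table v(s_a, s_b, r) for r = 1..n',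
   a, b < n (row-major in (r, a, b)), then V.  All other cells are 0. *)
Definition input_list (n' : nat) (s : seq nat) (v : nat -> nat -> nat -> int)
    (V : int) : seq int :=
  let n := size s in
  [:: (n%:Z)] ++ [seq (x%:Z) | x <- s]
  ++ flatten [seq flatten [seq [seq v (nth 0%N s a) (nth 0%N s b) r.+1
                                  | b <- iota 0 n]
                          | a <- iota 0 n]
             | r <- iota 0 n']
  ++ [:: V].

Definition init_config (n' : nat) (s : seq nat) (v : nat -> nat -> nat -> int)
    (V : int) : config :=
  Config 0 (fun x : int => if x is Posz m then nth 0 (input_list n' s v V) m
                           else 0).

(* Main.v *)
(** Write [M] for the strongest player and number the players by rank.  If the
    game values are win-count oriented, any two arrangements of the same set of
    players inside a block contribute the same amount to [tournament value -
    win-count sum].  Comparing arrangements that differ by swapping two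
    opponents shows that, for a game of round [j.+1] won by [w <> M] against [l],
    v(w, l) = v(M, l) + v(b, w) - v(b, M), where [b = 2 ^ j - 1] is the weakest
    player who can reach that round.  Hence an explicit player evaluation can be
    read off the game values.

    Seating the players from the strongest to the weakest, a partial seeding
    matters only through the number [h j] of still open blocks of each height
    [j]: whoever wins a block of height [j] opens one block of each smaller
    height.  The number of players still to be seated is [sum h j * 2 ^ j], so the
    vector [h], coded in base [n] by [sum h j * n ^ j < n ^ n'], is the whole
    state, and every transition decreases the code.  One pass over the codes in
    increasing order therefore fills the optimum table. *)
Require Import Defs.
From mathcomp Require Import all_boot all_order all_algebra.
From mathcomp Require Import zify ring.
Import Order.TTheory GRing.Theory Num.Theory.
Set Implicit Arguments. Unset Strict Implicit. Unset Printing Implicit Defensive.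
Local Open Scope ring_scope.

(** * Blocks *)

Definition seqmax (t : seq nat) : nat := \max_(x <- t) x.

Lemma seqmax_cat t1 t2 : seqmax (t1 ++ t2) = maxn (seqmax t1) (seqmax t2).
Proof. by rewrite /seqmax big_cat. Qed.

Lemma seqmax1 x : seqmax [:: x] = x.
Proof. by rewrite /seqmax big_seq1. Qed.

Lemma seqmax_ge t x : x \in t -> (x <= seqmax t)%N.
Proof. by move=> xt; rewrite /seqmax (big_rem x) //= leq_maxl. Qed.

Lemma seqmax_mem t : (0 < size t)%N -> seqmax t \in t.
Proof.
elim: t => // x [|y t] IH _; first by rewrite seqmax1 inE.
rewrite -cat1s seqmax_cat seqmax1 cat1s inE; case: (leqP x (seqmax (y :: t))) => h.
  by rewrite IH // orbT.
by rewrite eqxx.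
Qed.

Lemma seqmax_perm t1 t2 : perm_eq t1 t2 -> seqmax t1 = seqmax t2.
Proof. by move=> h; apply: perm_big. Qed.

Lemma seqmax_head x t : {in t, forall y, (y <= x)%N} -> seqmax (x :: t) = x.
Proof.
move=> h; rewrite -cat1s seqmax_cat seqmax1; apply/maxn_idPl.
by apply/bigmax_leqP_seq => y yt _; apply: h.
Qed.

Lemma pow2_split r (t : seq nat) : size t = (2 ^ r.+1)%N ->
  exists t1 t2, [/\ t = t1 ++ t2, size t1 = (2 ^ r)%N & size t2 = (2 ^ r)%N].
Proof.
move=> st; exists (take (2 ^ r) t), (drop (2 ^ r) t).
by rewrite cat_take_drop size_take_min size_drop st expnS; split=> //; lia.
Qed.

(* Common shape of the tournament value and of the win-count sum of a block:
   [b] scores the players, [g] the games. *)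
Fixpoint block_eval (b : nat -> int) (g : nat -> nat -> nat -> int) (r : nat)
    (t : seq nat) : int :=
  match r with
  | 0 => b (head 0%N t)
  | r'.+1 =>
      let t1 := take (2 ^ r') t in let t2 := drop (2 ^ r') t in
      block_eval b g r' t1 + block_eval b g r' t2 + g (seqmax t1) (seqmax t2) r
  end.

Lemma block_eval_cat b g r t1 t2 : size t1 = (2 ^ r)%N ->
  block_eval b g r.+1 (t1 ++ t2) =
    block_eval b g r t1 + block_eval b g r t2 + g (seqmax t1) (seqmax t2) r.+1.
Proof. by move=> s1 /=; rewrite -s1 take_size_cat // drop_size_cat. Qed.

Lemma tournE v r t : size t = (2 ^ r)%N ->
  tourn v r t = (seqmax t, block_eval (fun=> 0) v r t).
Proof.
elim: r t => [|r IH] t.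
  by case: t => // x [|//] _; rewrite /= seqmax1.
move=> /pow2_split [t1 [t2 [-> s1 s2]]].
rewrite block_eval_cat //= -{1 2 3 4 5 6}s1 take_size_cat // drop_size_cat // !IH //=.
by rewrite seqmax_cat.
Qed.

Lemma block_evalB b1 b2 g1 g2 r t :
  block_eval (fun x => b1 x - b2 x) (fun x y r => g1 x y r - g2 x y r) r t =
  block_eval b1 g1 r t - block_eval b2 g2 r t.
Proof. by elim: r t => [|r IH] t //=; rewrite !IH; ring. Qed.

(** Winning round [r] moves the winner's contribution from [p _ r.-1] to [p _ r], so charging each
    game this increment turns the win-count sum into a sum over games. That gives it the same shape
    as the tournament value. *)
Definition win_eval (p : nat -> nat -> int) : nat -> seq nat -> int :=
  block_eval (p^~ 0%N) (fun x y r => p (maxn x y) r - p (maxn x y) r.-1).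

Lemma win_eval_cat p r t1 t2 : size t1 = (2 ^ r)%N ->
  win_eval p r.+1 (t1 ++ t2) = win_eval p r t1 + win_eval p r t2 +
    (p (seqmax (t1 ++ t2)) r.+1 - p (seqmax (t1 ++ t2)) r).
Proof. by move=> s1; rewrite /win_eval block_eval_cat // seqmax_cat. Qed.

Lemma wins_cat r t1 t2 i : size t1 = (2 ^ r)%N -> size t2 = (2 ^ r)%N ->
  wins r.+1 (t1 ++ t2) i =
    (wins r t1 i + wins r t2 i + (i == seqmax (t1 ++ t2)))%N.
Proof.
move=> s1 s2; have st : size (t1 ++ t2) = (2 ^ r.+1)%N.
  by rewrite size_cat s1 s2 expnS; lia.
have -> : seqmax (t1 ++ t2) = (tourn (fun _ _ _ => 0) r.+1 (t1 ++ t2)).1.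
  by rewrite tournE.
by rewrite /= -{1 2}s1 take_size_cat // drop_size_cat.
Qed.

Lemma wins_notin r t i : size t = (2 ^ r)%N -> i \notin t -> wins r t i = 0%N.
Proof.
elim: r t => // r IH t st it.
have it' : i != seqmax t.
  by apply: contraNneq it => ->; rewrite seqmax_mem // st expn_gt0.
move: st it it' => /pow2_split [t1 [t2 [-> s1 s2]]].
rewrite mem_cat negb_or => /andP[i1 i2] im.
by rewrite wins_cat // !IH // (negPf im).
Qed.

Lemma wins_seqmax r t : uniq t -> size t = (2 ^ r)%N -> wins r t (seqmax t) = r.
Proof.
elim: r t => // r IH t ut /pow2_split [t1 [t2 [E s1 s2]]].
move: ut; rewrite E cat_uniq => /and3P[u1 /hasPn d u2].
rewrite wins_cat // eqxx seqmax_cat.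
have m1 : seqmax t1 \in t1 by rewrite seqmax_mem // s1 expn_gt0.
have m2 : seqmax t2 \in t2 by rewrite seqmax_mem // s2 expn_gt0.
case: leqP => h.
  by rewrite IH // wins_notin ?add0n ?addn1 //; apply: d.
rewrite IH // (@wins_notin _ t2) ?addn0 ?addn1 //.
by apply/negP => /d; rewrite m1.
Qed.

(** The increments telescope: a player enters with [p i 0], and only the maximum of a block gains a
    win when its halves merge, passing from [r] wins to [r.+1]. *)
Lemma sum_wins p r t : uniq t -> size t = (2 ^ r)%N ->
  \sum_(i <- t) p i (wins r t i) = win_eval p r t.
Proof.
elim: r t => [|r IH] t.
  by case: t => // x [|//] _ _; rewrite big_seq1.
move=> ut st; have mt : seqmax t \in t by rewrite seqmax_mem // st expn_gt0.
have wt : wins r.+1 t (seqmax t) = r.+1 by rewrite wins_seqmax.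
move: st => /pow2_split [t1 [t2 [E s1 s2]]].
have ut' := ut; move: ut'; rewrite E cat_uniq => /and3P[u1 /hasPn d u2].
rewrite win_eval_cat // -!IH // -E (bigD1_seq (seqmax t)) // wt.
have wt' : (wins r t1 (seqmax t) + wins r t2 (seqmax t) = r)%N.
  by move: wt; rewrite {1}E wins_cat // -E eqxx; lia.
have -> : \sum_(i <- t1) p i (wins r t1 i) + \sum_(i <- t2) p i (wins r t2 i) =
  \sum_(i <- t) p i (wins r t1 i + wins r t2 i)%N.
  rewrite E big_cat /=; congr (_ + _); apply: eq_big_seq => i it.
    by rewrite (@wins_notin _ t2) ?addn0 //; apply/negP => /d; rewrite it.
  by rewrite (@wins_notin _ t1) ?add0n //; apply: d.
rewrite [RHS]addrC [X in _ = _ + X](bigD1_seq (seqmax t)) // wt' addrA subrK; congr (_ + _).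
rewrite big_seq_cond [RHS]big_seq_cond; apply: eq_bigr => i /andP[_ im].
by rewrite {1}E wins_cat // -E (negPf im) addn0.
Qed.

(** * Consequences of win-count orientation *)

(** Games outside the leading block see only its maximum. In the induction [y] is cut so that
    [x ++ y1] is exactly the first half. *)
Lemma block_eval_prefix b g N r x x' y :
  size x = (2 ^ r)%N -> size x' = (2 ^ r)%N -> size (x ++ y) = (2 ^ N)%N ->
  seqmax x = seqmax x' ->
  block_eval b g N (x ++ y) - block_eval b g N (x' ++ y) =
  block_eval b g r x - block_eval b g r x'.
Proof.
move=> sx sx' + mx; elim: N y => [|N IH] y sxy.
  have le1 : (2 ^ r <= 2 ^ 0)%N by rewrite -sxy -sx size_cat leq_addr.
  have r0 : r = 0%N by move: le1; rewrite leq_exp2l //; lia.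
  have y0 : y = [::].
    by apply: size0nil; move: sxy; rewrite size_cat sx r0; lia.
  by rewrite y0 !cats0 r0.
have le1 : (2 ^ r <= 2 ^ N.+1)%N by rewrite -sxy -sx size_cat leq_addr.
have [rN|rN] := eqVneq r N.+1.
  have y0 : y = [::].
    by apply: size0nil; move: sxy; rewrite size_cat sx rN; lia.
  by rewrite y0 !cats0 rN.
have rN' : (2 ^ r <= 2 ^ N)%N.
  by move: le1; rewrite !leq_exp2l //; lia.
move: sxy; rewrite size_cat sx expnS => sy.
pose y1 := take (2 ^ N - 2 ^ r) y; pose y2 := drop (2 ^ N - 2 ^ r) y.
have s1 : size y1 = (2 ^ N - 2 ^ r)%N by rewrite size_take_min; lia.
have -> : y = y1 ++ y2 by rewrite cat_take_drop.
have sxy1 : size (x ++ y1) = (2 ^ N)%N by rewrite size_cat sx s1; lia.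
have sxy1' : size (x' ++ y1) = (2 ^ N)%N by rewrite size_cat sx' s1; lia.
rewrite !catA !block_eval_cat // -(IH y1) // !seqmax_cat mx.
by ring.
Qed.

Section ZeroEvaluation.

Variables (n' : nat) (b : nat -> int) (g : nat -> nat -> nat -> int).
Let n := (2 ^ n')%N.
Hypothesis H : forall t, perm_eq t (iota 0 n) -> block_eval b g n' t = 0.

Let seeding_of_block x : uniq x -> {in x, forall i, (i < n)%N} ->
  exists y, perm_eq (x ++ y) (iota 0 n).
Proof.
move=> ux xn; exists [seq i <- iota 0 n | i \notin x].
apply: uniq_perm; rewrite ?iota_uniq // ?cat_uniq ?ux ?filter_uniq ?iota_uniq //.
  rewrite andbT; apply/hasPn => i; rewrite mem_filter => /andP[//].
move=> i; rewrite mem_cat mem_filter mem_iota /=.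
by case: (boolP (i \in x)) => //= /xn ->.
Qed.

(** [H] is meant for tournament value minus win-count sum, which is itself a [block_eval].
    Completing both blocks by the same remaining players gives two seedings of evaluation 0, and
    everything outside the block cancels. *)
Lemma block_eval_perm r x x' : uniq x -> {in x, forall i, (i < n)%N} ->
  size x = (2 ^ r)%N -> perm_eq x x' -> block_eval b g r x = block_eval b g r x'.
Proof.
move=> ux xn sx pxx'; have [y py] := seeding_of_block ux xn.
have py' : perm_eq (x' ++ y) (iota 0 n).
  by apply: perm_trans py; rewrite perm_cat2r perm_sym.
have := @block_eval_prefix b g n' r x x' y sx.
rewrite -(perm_size pxx') sx (perm_size py) size_iota H // H //.
move=> /(_ erefl erefl (seqmax_perm pxx')).
by lia.
Qed.

Lemma game_sym r t1 t2 : uniq (t1 ++ t2) -> {in t1 ++ t2, forall i, (i < n)%N} ->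
  size t1 = (2 ^ r)%N -> size t2 = (2 ^ r)%N ->
  g (seqmax t1) (seqmax t2) r.+1 = g (seqmax t2) (seqmax t1) r.+1.
Proof.
move=> ut tn s1 s2; have st : size (t1 ++ t2) = (2 ^ r.+1)%N.
  by rewrite size_cat s1 s2 expnS; lia.
have := block_eval_perm ut tn st (permEl (perm_catC t1 t2)).
by rewrite !block_eval_cat //; lia.
Qed.

Lemma game_sym_least j a : (2 ^ j.+1 <= a.+1)%N -> (a < n)%N ->
  g a (2 ^ j - 1)%N j.+1 = g (2 ^ j - 1)%N a j.+1.
Proof.
move=> la an; have p0 : (0 < 2 ^ j)%N by rewrite expn_gt0.
rewrite expnS in la.
have m1 : seqmax (a :: iota (2 ^ j) (2 ^ j - 1)) = a.
  by apply: seqmax_head => y; rewrite mem_iota; lia.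
have m2 : seqmax ((2 ^ j - 1)%N :: iota 0 (2 ^ j - 1)) = (2 ^ j - 1)%N.
  by apply: seqmax_head => y; rewrite mem_iota; lia.
have := @game_sym j (a :: iota (2 ^ j) (2 ^ j - 1))
  ((2 ^ j - 1)%N :: iota 0 (2 ^ j - 1)).
rewrite m1 m2; apply; rewrite /= ?size_iota; try lia.
  rewrite mem_cat inE !mem_iota cat_uniq /= !mem_iota !iota_uniq !andbT /=.
  apply/and3P; split; try lia.
  rewrite negb_or; apply/andP; split; first lia.
  by apply/hasPn => x /=; rewrite !mem_iota; lia.
by move=> i; rewrite inE mem_cat inE !mem_iota; lia.
Qed.

(** In a block of four where [a] and [n.-1] win their first games, exchange the two losers: the
    second-round game is unaffected, so only the four first-round values remain. *)
Lemma first_round_exchange a b1 b2 : (b1 < a)%N -> (b2 < a)%N -> b1 != b2 ->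
  (a < n.-1)%N -> (1 < n')%N ->
  g a b1 1 - g n.-1 b1 1 = g a b2 1 - g n.-1 b2 1.
Proof.
move=> l1 l2 d12 an n1.
have M2 x y : (y < x)%N -> seqmax [:: x; y] = x.
  by move=> yx; apply: seqmax_head => z; rewrite inE; lia.
have := @block_eval_perm 2 ([:: a; b1] ++ [:: n.-1; b2]) ([:: a; b2] ++ [:: n.-1; b1]).
rewrite !block_eval_cat // !M2; try lia.
rewrite /= !seqmax1 => h.
suff : b a + b b1 + g a b1 1 + (b n.-1 + b b2 + g n.-1 b2 1) + g a n.-1 2
     = b a + b b2 + g a b2 1 + (b n.-1 + b b1 + g n.-1 b1 1) + g a n.-1 2 by lia.
apply: h => //; rewrite ?inE; first 1 [lia].
  by move=> i; rewrite !inE; lia.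
apply/permP => P /=; lia.
Qed.

(** Exchange [b1] and [b2] between two half blocks. The half of [c] changes only in its first game,
    as [c] wins throughout; the other half is [Z] together with [b2] or [b1], and its change does
    not depend on [c]. *)
Lemma round_exchange j c b2 (b1 := (2 ^ j - 1)%N) (Z := iota 0 b1) :
  (0 < j)%N -> (b1 < b2)%N -> (b2 < c)%N -> (2 ^ j.+1 <= c.+1)%N -> (c < n)%N ->
  b b1 - b b2 + (g c b1 1 - g c b2 1)
  + (block_eval b g j (b2 :: Z) - block_eval b g j (b1 :: Z))
  + (g c b2 j.+1 - g c b1 j.+1) = 0.
Proof.
move=> j0 l12 l2 lc cn; rewrite expnS in lc.
have p0 : (2 <= 2 ^ j)%N by rewrite -{1}(expn1 2) leq_exp2l.
(* Fillers for the half of [c]: players from [2 ^ j] up to [c], without [b2]. The bound on [c]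
   leaves at least the [2 ^ j - 2] that are required. *)
pose F := take (2 ^ j - 2) (rem b2 (iota (2 ^ j) (c - 2 ^ j))).
have uF : uniq F by rewrite take_uniq // rem_uniq // iota_uniq.
have inF i : i \in F -> [&& (2 ^ j <= i)%N, (i < c)%N & i != b2].
  move=> /mem_take; rewrite mem_rem_uniq ?iota_uniq // inE mem_iota /=; lia.
have sF : size F = (2 ^ j - 2)%N.
  rewrite size_take_min size_rem ?size_iota ?mem_iota; lia.
have sZ : size Z = b1 by rewrite size_iota.
have inZ i : i \in Z = (i < b1)%N by rewrite mem_iota.
have M2 x y : (y < x)%N -> seqmax [:: x; y] = x.
  by move=> yx; apply: seqmax_head => z; rewrite inE; lia.
have Mc x : (x < c)%N -> seqmax ([:: c; x] ++ F) = c.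
  by move=> xc; apply: seqmax_head => z; rewrite inE => /orP[/eqP->|/inF]; lia.
have MZ x : (b1 <= x)%N -> seqmax (x :: Z) = x.
  by move=> bx; apply: seqmax_head => z; rewrite inZ; lia.
have := @block_eval_perm j.+1 (([:: c; b1] ++ F) ++ b2 :: Z) (([:: c; b2] ++ F) ++ b1 :: Z).
rewrite !block_eval_cat ?Mc ?MZ; try (rewrite /= ?sF; lia).
have := @block_eval_prefix b g j 1 [:: c; b1] [:: c; b2] F erefl erefl.
rewrite !M2; try lia.
move=> /(_ _ erefl) E E2.
have {}E : block_eval b g j ([:: c; b1] ++ F) - block_eval b g j ([:: c; b2] ++ F)
   = b b1 - b b2 + (g c b1 1 - g c b2 1).
  rewrite E /= ?sF; last by lia.
  by rewrite !seqmax1; ring.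
rewrite -E; suff : block_eval b g j ([:: c; b1] ++ F) + block_eval b g j (b2 :: Z) +
  g c b2 j.+1 = block_eval b g j ([:: c; b2] ++ F) + block_eval b g j (b1 :: Z) +
  g c b1 j.+1 by lia.
apply: E2.
- have nF x : (x < 2 ^ j)%N || (x == b2) || (c <= x)%N -> x \notin F.
    by move=> h; apply/negP => /inF; lia.
  rewrite cat_uniq; apply/and3P; split.
  + have cF := nF c ltac:(lia); have bF := nF b1 ltac:(lia).
    by rewrite /= inE negb_or uF cF bF; lia.
  + apply/hasPn => x xZ; have xb : (x == b2) || (x < b1)%N by rewrite -inZ -in_cons.
    by rewrite mem_cat !inE (negPf (nF x _)); lia.
  + by rewrite /= inZ iota_uniq; lia.
- move=> i; rewrite mem_cat !inE inZ => /orP[|]; last by lia.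
  by case/or3P => [||/inF]; lia.
- by rewrite size_cat /= sF sZ expnS; lia.
- by apply/permP => P /=; rewrite !count_cat /=; lia.
Qed.

(* The candidate opponent [2 ^ j - 1] is the weakest player able to reach round
   [j.+1], hence is available whatever the winner [a] is. *)
Lemma game_separable j a b2 : (j.+1 < n')%N -> (2 ^ j <= b2.+1)%N -> (b2 < a)%N ->
  (2 ^ j.+1 <= a.+1)%N -> (a < n.-1)%N ->
  g a b2 j.+1 - g n.-1 b2 j.+1 =
  g (2 ^ j - 1)%N a j.+1 - g (2 ^ j - 1)%N n.-1 j.+1.
Proof.
move=> jn lb ba la an.
have ln : (2 ^ j.+1 <= n.-1.+1)%N by lia.
rewrite -!game_sym_least //; try lia.
have [->|d] := eqVneq b2 (2 ^ j - 1)%N; first by [].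
have [j0|j0] := posnP j.
  by rewrite j0 expn0 in lb jn d *; apply: first_round_exchange; lia.
(* Subtracting the instances for [a] and [n.-1] cancels all terms free of [c]; the first-round
   differences left over cancel by [first_round_exchange]. *)
have := @round_exchange j a b2 j0; have := @round_exchange j n.-1 b2 j0.
have := @first_round_exchange a (2 ^ j - 1)%N b2.
move=> h1 h2 h3.
have {}h1 := h1 ltac:(lia) ltac:(lia) ltac:(lia) ltac:(lia) ltac:(lia).
have {}h2 := h2 ltac:(lia) ltac:(lia) ltac:(lia) ltac:(lia).
have {}h3 := h3 ltac:(lia) ltac:(lia) ltac:(lia) ltac:(lia).
by lia.
Qed.

End ZeroEvaluation.

(** * Player evaluation *)

Lemma seqmax_rank r t : uniq t -> size t = (2 ^ r)%N ->
  (2 ^ r <= (seqmax t).+1)%N.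
Proof.
move=> ut <-; rewrite -(size_iota 0 (seqmax t).+1); apply: uniq_leq_size => //.
by move=> i /seqmax_ge it; rewrite mem_iota.
Qed.

(* Player evaluation read off the game values: a player who is not the overall
   winner [n.-1] is charged the game he loses as if he lost it to [n.-1], and
   every round [r.+1] he wins contributes the difference between him and [n.-1]
   as opponents of [2 ^ r - 1]. *)
Definition score (v : nat -> nat -> nat -> int) (n k j : nat) : int :=
  if k == n.-1 then 0 else
  v n.-1 k j.+1 +
  \sum_(r < j) (v (2 ^ r - 1)%N k r.+1 - v (2 ^ r - 1)%N n.-1 r.+1).

Section Score.

Variables (n' : nat) (v : nat -> nat -> nat -> int) (p : nat -> nat -> int).
Let n := (2 ^ n')%N.
Hypothesis vp : forall t, perm_eq t (iota 0 n) ->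
  block_eval (fun=> 0) v n' t = win_eval p n' t.

Let b x := 0 - p x 0%N.
Let g x y r := v x y r - (p (maxn x y) r - p (maxn x y) r.-1).

Let g0 t : perm_eq t (iota 0 n) -> block_eval b g n' t = 0.
Proof. by move=> pt; rewrite block_evalB vp // /win_eval subrr. Qed.

Lemma value_sym r t1 t2 : uniq (t1 ++ t2) -> {in t1 ++ t2, forall i, (i < n)%N} ->
  size t1 = (2 ^ r)%N -> size t2 = (2 ^ r)%N ->
  v (seqmax t1) (seqmax t2) r.+1 = v (seqmax t2) (seqmax t1) r.+1.
Proof.
move=> ut tn s1 s2; have := game_sym g0 ut tn s1 s2.
by rewrite /g (maxnC (seqmax t2)) => /addIr.
Qed.

(** The [p] part of [g] depends only on the winner and the round. Each side contains the difference
    between the winners [w] and [n.-1], so [p] disappears. *)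
Lemma value_separable j w l : (j.+1 < n')%N -> (2 ^ j <= l.+1)%N -> (l < w)%N ->
  (2 ^ j.+1 <= w.+1)%N -> (w < n.-1)%N ->
  v w l j.+1 = v n.-1 l j.+1 + (v (2 ^ j - 1)%N w j.+1 - v (2 ^ j - 1)%N n.-1 j.+1).
Proof.
move=> jn ll lw lew wn; have := game_separable g0 jn ll lw lew wn.
have p0 : (0 < 2 ^ j)%N by rewrite expn_gt0.
rewrite expnS in lew; rewrite /g -/n.
have -> : maxn w l = w by lia.
have -> : maxn n.-1 l = n.-1 by lia.
have -> : maxn (2 ^ j - 1) w = w by lia.
have -> : maxn (2 ^ j - 1) n.-1 = n.-1 by lia.
by lia.
Qed.

(** The added term is the pending loss to [n.-1] that [score] charges to the block winner. When
    blocks won by [w] and [l] merge, [w] trades his pending charge for that of the next round, and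
    the charge of [l] becomes the real game by [value_separable]. *)
Lemma block_eval_score r t : uniq t -> {in t, forall i, (i < n)%N} ->
  size t = (2 ^ r)%N ->
  block_eval (fun=> 0) v r t + (if n.-1 \in t then 0 else v n.-1 (seqmax t) r.+1) =
  win_eval (score v n) r t.
Proof.
have n0 : (0 < n)%N by rewrite expn_gt0.
elim: r t => [|r IH] t ut tn.
  case: t ut tn => // x [|//] _ _ _.
  rewrite /win_eval /= seqmax1 inE eq_sym /score big_ord0 addr0 add0r.
  by case: eqP.
move=> st; have rt := seqmax_rank ut st.
have mt : seqmax t \in t by rewrite seqmax_mem // st expn_gt0.
have rn : n.-1 \notin t -> (r.+1 < n')%N.
  move=> Mt; have : (size (n.-1 :: t) <= size (iota 0 n))%N.
    apply: uniq_leq_size; rewrite /= ?Mt // => i.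
    by rewrite inE mem_iota => /orP[/eqP->|/tn]; lia.
  by rewrite size_iota /= st ltn_exp2l.
have wn : n.-1 \notin t -> (seqmax t < n.-1)%N.
  move=> Mt; have := tn _ mt; have : seqmax t != n.-1; last by lia.
  by apply: contraNneq Mt => <-.
move: st => /pow2_split [t1 [t2 [E s1 s2]]].
have tn1 : {in t1, forall i, (i < n)%N} by move=> i it; apply: tn; rewrite E mem_cat it.
have tn2 : {in t2, forall i, (i < n)%N}.
  by move=> i it; apply: tn; rewrite E mem_cat it orbT.
have ut' := ut; move: ut'; rewrite E cat_uniq => /and3P[u1 /hasPn d u2].
have m1 : seqmax t1 \in t1 by rewrite seqmax_mem // s1 expn_gt0.
have m2 : seqmax t2 \in t2 by rewrite seqmax_mem // s2 expn_gt0.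
have r1 := seqmax_rank u1 s1; have r2 := seqmax_rank u2 s2.
have l1 := tn1 _ m1; have l2 := tn2 _ m2.
have sym : v (seqmax t1) (seqmax t2) r.+1 = v (seqmax t2) (seqmax t1) r.+1.
  by apply: value_sym; rewrite -?E.
have Mmax u : n.-1 \in u -> {in u, forall i, (i < n)%N} -> seqmax u = n.-1.
  move=> Mu un; have := seqmax_ge Mu.
  by have := un _ (seqmax_mem _); case: (u) Mu => // ? ? _ /(_ erefl); lia.
rewrite block_eval_cat // win_eval_cat // -!IH // -E.
case: (boolP (n.-1 \in t)) => Mt.
  (* If [n.-1] is in the block, the pending charge of the other half is the game actually played, up
     to the order of the opponents, which [sym] settles. *)
  rewrite (Mmax _ Mt tn) /score eqxx.
  have /orP[M1|M2] : (n.-1 \in t1) || (n.-1 \in t2) by rewrite -mem_cat -E.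
    have M2 : n.-1 \notin t2 by apply/negP => /d; rewrite M1.
    by rewrite M1 (negPf M2) (Mmax _ M1 tn1); ring.
  have M1 : n.-1 \notin t1 by apply: d.
  by rewrite sym M2 (negPf M1) (Mmax _ M2 tn2); ring.
have {}rn := rn Mt; have {}wn := wn Mt.
have /andP[M1 M2] : (n.-1 \notin t1) && (n.-1 \notin t2).
  by rewrite -negb_or -mem_cat -E.
rewrite (negPf M1) (negPf M2) /score.
have -> : (seqmax t == n.-1) = false by lia.
rewrite big_ord_recr /=.
have ne : seqmax t1 != seqmax t2 by apply/negP => /eqP e; move/d: m2; rewrite -e m1.
have Et : seqmax t = maxn (seqmax t1) (seqmax t2) by rewrite E seqmax_cat.
case: (ltngtP (seqmax t1) (seqmax t2)) ne => // h _.
  have e : seqmax t = seqmax t2 by rewrite Et; lia.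
  rewrite sym e in wn rt *; rewrite (value_separable rn r1 h rt wn).
  by ring.
have e : seqmax t = seqmax t1 by rewrite Et; lia.
rewrite e in wn rt *; rewrite (value_separable rn r2 h rt wn).
by ring.
Qed.

Lemma seeding_score t : perm_eq t (iota 0 n) ->
  block_eval (fun=> 0) v n' t = win_eval (score v n) n' t.
Proof.
move=> pt; have it i : i \in t = (i < n)%N by rewrite (perm_mem pt) mem_iota.
rewrite -block_eval_score //.
- by rewrite it prednK ?expn_gt0 // leqnn addr0.
- by rewrite (perm_uniq pt) iota_uniq.
- by move=> i; rewrite it.
- by rewrite (perm_size pt) size_iota.
Qed.

End Score.

(* [h j] is the number of open slots of height [j], i.e. of blocks of [2 ^ j]
   positions still to be filled with the [k] weakest players.  The strongest of
   them wins one of these blocks, which opens one slot of each smaller height. *)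
Inductive play (sc : nat -> nat -> int) : nat -> (nat -> nat) -> int -> Prop :=
| PlayDone h : (forall i, h i = 0%N) -> play sc 0 h 0
| PlayTake k h h' j x : (0 < h j)%N ->
    (forall i, h' i + (i == j) = h i + (i < j))%N ->
    play sc k h' x -> play sc k.+1 h (sc k j + x).

(** * Forests of blocks and partial seedings *)

Section Forest.

Variable sc : nat -> nat -> int.
Implicit Types (F G : seq (nat * seq nat)).

Definition wf_blocks F := all (fun B => size B.2 == 2 ^ B.1)%N F.
Definition players F := flatten [seq B.2 | B <- F].
Definition nblocks F i := count (fun B => B.1 == i) F.
Definition forest_eval F := \sum_(B <- F) win_eval sc B.1 B.2.

(** Player [k], stronger than everyone in [F], starts as a block of height 0 and beats one block of
    each height below [j] in turn. His score increments telescope to [sc k j]. *)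
Lemma forest_merge k F j : wf_blocks F -> perm_eq (players F) (iota 0 k) ->
  (forall i, (i < j)%N -> (0 < nblocks F i)%N) ->
  exists K G, [/\ size K = (2 ^ j)%N, wf_blocks G,
    perm_eq (K ++ players G) (iota 0 k.+1) /\ k \in K,
    forall i, (nblocks F i = nblocks G i + (i < j))%N &
    win_eval sc j K + forest_eval G = sc k j + forest_eval F].
Proof.
move=> wF pF; elim: j => [|j IH] hj.
  exists [:: k], F; split=> //; last by move=> i; rewrite addn0.
  split; last by rewrite inE.
  by rewrite -addn1 iotaD perm_catC perm_cat2r.
case: IH => [i ij|K [G [sK wG [pK kK] cG eG]]]; first by apply: hj; lia.
have : has (fun B => B.1 == j) G.
  by have := hj j (leqnn _); rewrite has_count cG ltnn addn0.
case/hasP => -[j' B] BG /= /eqP jj; rewrite {j'}jj in BG.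
have pG := perm_to_rem BG.
have sB : size B = (2 ^ j)%N by apply/eqP; have /allP/(_ _ BG) := wG.
have mK : seqmax (K ++ B) = k.
  have kKB : k \in K ++ B by rewrite mem_cat kK.
  have sKB : {subset K ++ B <= iota 0 k.+1}.
    move=> i; rewrite -(perm_mem pK) !mem_cat => /orP[->//|iB].
    by apply/orP; right; apply/flattenP; exists B => //; apply/mapP; exists (j, B).
  have := seqmax_ge kKB; have := sKB _ (seqmax_mem _).
  by rewrite mem_iota; case: (K ++ B) kKB => // ? ? _ /(_ erefl); lia.
exists (K ++ B), (rem (j, B) G); split.
- by rewrite size_cat sK sB expnS; lia.
- by apply/allP => x /mem_rem xG; move/allP: wG; apply.
- split; last by rewrite mem_cat kK.
  apply: perm_trans pK; rewrite -catA perm_cat2l perm_sym.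
  by have := perm_flatten (perm_map snd pG).
- move=> i; rewrite cG /nblocks (permP pG) /= ltnS leq_eqVlt (eq_sym j).
  by case: (ltngtP i j) => //=; lia.
rewrite win_eval_cat // mK.
have := perm_big _ pG : forest_eval G = _; rewrite big_cons /= -/(forest_eval _) => eG'.
by move: eG; rewrite eG'; lia.
Qed.

(** Inverse of [forest_merge]: undoing the rounds won by the strongest player [k] releases one
    beaten block of each height below [j]. *)
Lemma block_peel k j B : size B = (2 ^ j)%N -> k \in B ->
  {in B, forall i, (i <= k)%N} ->
  exists G, [/\ wf_blocks G, perm_eq (k :: players G) B,
    forall i, nblocks G i = (i < j)%N &
    win_eval sc j B = sc k j + forest_eval G].
Proof.
elim: j B => [|j IH] B.
  case: B => // y [|//] _; rewrite inE => /eqP <- _; exists [::].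
  by split=> //; rewrite /forest_eval big_nil addr0.
move=> /pow2_split [B1 [B2 [-> s1 s2]]] kB Bk.
have mB : seqmax (B1 ++ B2) = k.
  have := Bk _ (seqmax_mem _); have := seqmax_ge kB.
  by case: (B1 ++ B2) kB => // ? ? _ + /(_ erefl); lia.
rewrite win_eval_cat // mB.
(* Stated for an arbitrary ordered pair of halves, so that it serves whichever half contains [k]. *)
have wl : forall B B', size B = (2 ^ j)%N -> size B' = (2 ^ j)%N -> k \in B ->
    {in B, forall i, (i <= k)%N} ->
    exists G, [/\ wf_blocks G, perm_eq (k :: players G) (B ++ B'),
    forall i, nblocks G i = (i < j.+1)%N &
    win_eval sc j B + win_eval sc j B' + (sc k j.+1 - sc k j) =
    sc k j.+1 + forest_eval G].
  move=> C C' sC sC' kC Ck; have [G [wG pG cG eG]] := IH C sC kC Ck.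
  exists ((j, C') :: G); split.
  - by rewrite /= sC' eqxx.
  - rewrite /players /= -cat1s catA perm_catAC.
    by rewrite perm_cat2r.
  - by move=> i; rewrite /nblocks /= -/(nblocks _ _) cG; lia.
  by rewrite /forest_eval big_cons /= -/(forest_eval _) eG; ring.
have Bk1 : {in B1, forall i, (i <= k)%N} by move=> i h; apply: Bk; rewrite mem_cat h.
have Bk2 : {in B2, forall i, (i <= k)%N}.
  by move=> i h; apply: Bk; rewrite mem_cat h orbT.
move: kB; rewrite mem_cat => /orP[k1|k2].
  exact: wl.
have [G [wG pG cG eG]] := wl _ _ s2 s1 k2 Bk2.
exists G; split=> //; last by rewrite -eG; ring.
by rewrite (perm_trans pG) // perm_catC.
Qed.

(** This justifies keeping only slot counts as the state. A play is turned into blocks from the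
    weakest player up by [forest_merge]; blocks are turned into a play from the strongest down by
    [block_peel]. *)
Lemma play_forest k h x : play sc k h x <->
  exists F, [/\ wf_blocks F, perm_eq (players F) (iota 0 k),
                forall i, nblocks F i = h i & forest_eval F = x].
Proof.
split.
  elim=> {k h x} [h h0|k h h' j x hj hh' _ [F [wF pF cF eF]]].
    by exists [::]; split=> //; rewrite /forest_eval big_nil.
  case: (@forest_merge k F j wF pF) => [i ij|K [G [sK wG [pK _] cG eG]]].
    by rewrite cF; have := hh' i; lia.
  exists ((j, K) :: G); split=> //.
  - by rewrite /= sK eqxx.
  - move=> i; rewrite /nblocks /= -/(nblocks _ _).
    by have := hh' i; rewrite -cF cG eq_sym; lia.
  by rewrite -eF -eG /forest_eval big_cons.
elim: k h x => [|k IH] h x [F [wF pF cF eF]].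
  have F0 : F = [::].
    case: F wF pF {cF eF} => // -[j B] F /= /andP[/eqP sB _].
    move=> /perm_size; rewrite /players /= size_cat sB /=.
    by have := expn_gt0 2 j; lia.
  rewrite -eF F0 /forest_eval big_nil; apply: PlayDone => i.
  by rewrite -cF F0.
have : k \in players F by rewrite (perm_mem pF) mem_iota; lia.
case/flattenP => B /mapP [[j B'] BF /= ->] kB {B}.
have pG := perm_to_rem BF.
have sB : size B' = (2 ^ j)%N by apply/eqP; have /allP/(_ _ BF) := wF.
have Bk : {in B', forall i, (i <= k)%N}.
  move=> i iB; have : i \in players F.
    by apply/flattenP; exists B' => //; apply/mapP; exists (j, B').
  by rewrite (perm_mem pF) mem_iota; lia.
have [G [wG pkG cG eG]] := block_peel sB kB Bk.
pose F' := rem (j, B') F.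
have cF' i : (h i = (j == i) + nblocks F' i)%N by rewrite -cF /nblocks (permP pG).
have -> : x = sc k j + (forest_eval G + forest_eval F').
  rewrite -eF /forest_eval (perm_big _ pG) big_cons /= eG -/(forest_eval _) .
  by rewrite -/F'; ring.
apply: (@PlayTake _ _ _ (nblocks (G ++ F'))).
- by rewrite cF' eqxx.
- by move=> i; rewrite /nblocks count_cat -!/(nblocks _ _) cG cF' eq_sym; lia.
apply: IH; exists (G ++ F'); split=> //.
- rewrite /wf_blocks all_cat; apply/andP; split=> //.
  by apply/allP => y /mem_rem yF; move/allP: wF; apply.
- rewrite -(perm_cons k) /players map_cat flatten_cat -cat_cons.
  apply: (@perm_trans _ (B' ++ players F')); first by rewrite perm_cat2r.
  apply: (@perm_trans _ (players F)).
    by rewrite perm_sym; have := perm_flatten (perm_map snd pG).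
  apply: perm_trans pF _; rewrite -cat1s -{1}addn1 iotaD /=.
  by rewrite add0n perm_catC.
by rewrite /forest_eval big_cat.
Qed.

Lemma play_seeding r h x : (forall i, h i = (i == r)) ->
  play sc (2 ^ r) h x <->
  exists t, perm_eq t (iota 0 (2 ^ r)) /\ win_eval sc r t = x.
Proof.
move=> hE; rewrite play_forest; split.
  case=> F [wF pF cF eF].
  have : has (fun B => B.1 == r) F by rewrite has_count -/(nblocks F r) cF hE eqxx.
  case/hasP => -[r' B] BF /= /eqP rr; rewrite {r'}rr in BF.
  have pG := perm_to_rem BF.
  have G0 : rem (r, B) F = [::].
    case E : (rem _ _) => [//|[j C] G].
    have := cF j; rewrite /nblocks (permP pG) E /= hE eqxx eq_sym; lia.
  rewrite G0 in pG.
  exists B; split.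
    apply: perm_trans pF; rewrite perm_sym.
    by have := perm_flatten (perm_map snd pG); rewrite /= cats0.
  by rewrite -eF /forest_eval (perm_big _ pG) big_seq1.
case=> t [pt et]; exists [:: (r, t)]; split=> //.
- by rewrite /= (perm_size pt) size_iota eqxx.
- by rewrite /players /= cats0.
- by move=> i; rewrite hE /nblocks /= addn0 eq_sym.
by rewrite /forest_eval big_seq1.
Qed.

End Forest.

(** * Reindexing by rank *)

Lemma playS sc k h x : play sc k.+1 h x <->
  exists h' j y, [/\ (0 < h j)%N, forall i, (h' i + (i == j) = h i + (i < j))%N,
                     play sc k h' y & x = sc k j + y].
Proof.
split; last by case=> h' [j [y [hj hh' py ->]]]; apply: PlayTake py.
move E: k.+1 => k1 pk; case: k1 h x / pk E => // k1 h h' j x hj hh' px [->].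
by exists h', j, x.
Qed.

Lemma play_ext sc k h1 h2 x : h1 =1 h2 -> play sc k h1 x -> play sc k h2 x.
Proof.
move=> e; case: k => [|k].
  move E: 0%N => k1 pk; case: k1 h1 x / pk E e => // h1 h0 _ e.
  by apply: PlayDone => i; rewrite -e.
case/playS => h' [j [y [hj hh' py ->]]]; apply: PlayTake py; first by rewrite -e.
by move=> i; rewrite -e.
Qed.

(** The first move is forced and free: the only slot goes to the champion, whose score is 0, and one
    slot of each smaller height opens. *)
Lemma play_champion v r x :
  play (score v (2 ^ r)) (2 ^ r) (fun i => i == r) x <->
  play (score v (2 ^ r)) (2 ^ r).-1 (fun i => i < r)%N x.
Proof.
have n0 : (0 < 2 ^ r)%N by rewrite expn_gt0.
have sM : score v (2 ^ r) (2 ^ r).-1 r = 0 by rewrite /score eqxx.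
rewrite -{2}(prednK n0) playS; split=> [[h' [j [y [hj hh' py ->]]]]|px].
  have jr : j = r by move: hj; case: eqP.
  rewrite jr sM add0r; apply: play_ext py => i.
  by have := hh' i; rewrite jr; lia.
exists (fun i => i < r)%N, r, x; split; rewrite ?eqxx ?sM ?add0r //.
by move=> i; lia.
Qed.

Section Reindexing.

Variables (n' : nat) (s : seq nat) (v : nat -> nat -> nat -> int) (V : int).
Hypotheses (ss : sorted ltn s) (szs : size s = (2 ^ n')%N).
Let n := (2 ^ n')%N.
Let f := nth 0%N s.

Definition rank_value (a b r : nat) : int := v (nth 0%N s a) (nth 0%N s b) r.

Let us : uniq s.
Proof. by apply: sorted_uniq ss; [apply: ltn_trans | apply: ltnn]. Qed.

Let f_max x y : (x < n)%N -> (y < n)%N -> maxn (f x) (f y) = f (maxn x y).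
Proof.
have mono i j : (i < j)%N -> (j < n)%N -> (f i < f j)%N.
  move=> ij jn; apply: (sorted_ltn_nth ltn_trans) => //; rewrite inE szs //.
  exact: ltn_trans jn.
move=> xn yn; case: (ltngtP x y) => [/mono/(_ yn)|/mono/(_ xn)|->]; lia.
Qed.

Let in_map_cat t1 t2 : {in t1 ++ t2, forall i, (i < n)%N} ->
  {in t1, forall i, (i < n)%N} /\ {in t2, forall i, (i < n)%N}.
Proof. by move=> h; split=> i it; apply: h; rewrite mem_cat it ?orbT. Qed.

Let seqmax_map t : (0 < size t)%N -> {in t, forall i, (i < n)%N} ->
  seqmax (map f t) = f (seqmax t).
Proof.
elim: t => // x [|y t] IH _ h; first by rewrite /= !seqmax1.
rewrite -cat1s in h; have [h1 h2] := in_map_cat h.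
rewrite -cat1s map_cat !seqmax_cat IH // [map f [:: x]]/= !seqmax1 f_max //.
  by apply: h1; rewrite inE.
by apply: h2; apply: seqmax_mem.
Qed.

Let block_eval_map b g b' g' r t :
  (forall x, (x < n)%N -> b (f x) = b' x) ->
  (forall x y r, (x < n)%N -> (y < n)%N -> g (f x) (f y) r = g' x y r) ->
  {in t, forall i, (i < n)%N} -> size t = (2 ^ r)%N ->
  block_eval b g r (map f t) = block_eval b' g' r t.
Proof.
move=> hb hg; elim: r t => [|r IH] t.
  by case: t => // x [|//] h _ /=; apply: hb; apply: h; rewrite inE.
move=> h /pow2_split [t1 [t2 [E s1 s2]]]; rewrite {t}E in h *.
have [h1 h2] := in_map_cat h.
have p0 : (0 < 2 ^ r)%N by rewrite expn_gt0.
rewrite map_cat !block_eval_cat ?size_map // !IH // !seqmax_map ?s1 ?s2 //.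
by rewrite hg //; [apply: h1|apply: h2]; apply: seqmax_mem; rewrite ?s1 ?s2.
Qed.

Let perm_mapP t : perm_eq t s <->
  exists t', perm_eq t' (iota 0 n) /\ t = map f t'.
Proof.
have sE : s = map f (iota 0 n) by rewrite -[LHS](mkseq_nth 0%N) szs.
split=> [pt|[t' [pt ->]]]; last by rewrite sE perm_map.
exists (map (index^~ s) t); split; last first.
  rewrite -map_comp map_id_in // => x xt /=.
  by rewrite /f nth_index // -(perm_mem pt).
rewrite (perm_trans (perm_map _ pt)) //.
suff -> : map (index^~ s) s = iota 0 n by [].
apply: (@eq_from_nth _ 0%N) => [|i]; first by rewrite size_map size_iota.
rewrite size_map => ii.
by rewrite (nth_map 0%N) // index_uniq // /n -szs nth_iota.
Qed.

(** The hypothesis only asserts that some [p] exists. It is used to validate [score], which is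
    computed from the input values alone and is therefore available to a program. *)
Lemma TVM_play : win_count_oriented n' s v ->
  TVM_yes n' s v V <->
  exists x, V <= x /\ play (score rank_value n) n.-1 (fun i => i < n')%N x.
Proof.
case=> p hp.
have tv t' : perm_eq t' (iota 0 n) ->
    Defs.tval v n' (map f t') = block_eval (fun=> 0) rank_value n' t'.
  move=> pt; have st : size t' = n by rewrite (perm_size pt) size_iota.
  rewrite /Defs.tval tournE ?size_map //=; apply: block_eval_map => // i.
  by rewrite (perm_mem pt) mem_iota.
have wco t' : perm_eq t' (iota 0 n) ->
    block_eval (fun=> 0) rank_value n' t' = win_eval (fun k => p (f k)) n' t'.
  move=> pt; have st : size t' = n by rewrite (perm_size pt) size_iota.
  have pft : perm_eq (map f t') s by apply/perm_mapP; exists t'.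
  rewrite -tv // hp // -(perm_big _ pft) /= sum_wins ?size_map //; last first.
    by rewrite (perm_uniq pft).
  apply: block_eval_map => // [x y r xn yn|i]; first by rewrite f_max.
  by rewrite (perm_mem pt) mem_iota.
have sc := seeding_score wco.
split=> [[t [/perm_mapP [t' [pt' ->]]]]|[x [Vx]]].
  rewrite tv // sc // => Vx; exists (win_eval (score rank_value n) n' t').
  split=> //; apply/play_champion/play_seeding; first by [].
  by exists t'.
move=> /play_champion /play_seeding => /(_ (fun=> erefl)) [t' [pt' ex]].
exists (map f t'); split; first by apply/perm_mapP; exists t'.
by rewrite tv // sc // ex.
Qed.

End Reindexing.

(** * Layout of the input *)

Lemma nth_flatten_iota (F : nat -> seq int) m k i j :
  (forall i, size (F i) = m) -> (i < k)%N -> (j < m)%N ->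
  nth 0 (flatten [seq F i | i <- iota 0 k]) (i * m + j) = nth 0 (F i) j.
Proof.
move=> sF; elim: k i F sF => // k IH i F sF.
case: i => [|i] ik jm; rewrite /= nth_cat sF; first by rewrite add0n jm.
rewrite mulSn -addnA ltnNge leq_addr /= addKn.
rewrite -[1%N]addn0 iotaDl -map_comp.
by rewrite (IH i (fun i => F (1 + i)%N)).
Qed.

Lemma size_flatten_iota (F : nat -> seq int) m k :
  (forall i, size (F i) = m) -> size (flatten [seq F i | i <- iota 0 k]) = (k * m)%N.
Proof.
move=> sF; elim: k F sF => // k IH F sF.
by rewrite /= size_cat sF mulSn -[1%N]addn0 iotaDl -map_comp (IH (F \o addn 1)) // => i /=.
Qed.

Section Input.

Variables (n' : nat) (s : seq nat) (v : nat -> nat -> nat -> int) (V : int).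
Let n := size s.
Let inp := nth 0 (input_list n' s v V).

Let row r a := [seq v (nth 0%N s a) (nth 0%N s b) r.+1 | b <- iota 0 n].
Let layer r := flatten [seq row r a | a <- iota 0 n].

Let size_row r a : size (row r a) = n.
Proof. by rewrite size_map size_iota. Qed.

Let size_layer r : size (layer r) = (n * n)%N.
Proof. exact: size_flatten_iota. Qed.

Lemma input_size : inp 0%N = n%:Z.
Proof. by []. Qed.

Lemma input_value r a b : (r < n')%N -> (a < n)%N -> (b < n)%N ->
  inp (1 + n + r * (n * n) + a * n + b)%N = rank_value s v a b r.+1.
Proof.
move=> rn an bn; rewrite /inp /input_list -/n.
rewrite -!addnA /= nth_cat size_map -/n ltnNge leq_addr /= add0n addKn.
have lt2 : (a * n + b < n * n)%N by nia.
have sz := size_flatten_iota n' size_layer; rewrite /layer /row in sz.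
rewrite nth_cat sz ifT; last by nia.
by rewrite (nth_flatten_iota size_layer) // (nth_flatten_iota (size_row r)) //
  (nth_map 0%N) ?size_iota // nth_iota.
Qed.

Lemma input_threshold : inp (1 + n + n' * (n * n))%N = V.
Proof.
rewrite /inp /input_list -/n.
rewrite -!addnA /= nth_cat size_map -/n ltnNge leq_addr /= add0n addKn.
have sz := size_flatten_iota n' size_layer; rewrite /layer /row in sz.
by rewrite nth_cat sz ltnn subnn.
Qed.

End Input.

(** * Structured programs for the RAM *)

(* Register [i] is the memory cell [Negz i], that is [- i.+1]. *)
Definition nregs : nat := 24.

Inductive op :=
  | OSet of nat & int
  | OAdd of nat & nat & nat
  | OSub of nat & nat & nat
  | OLoad of nat & nat
  | OStore of nat & nat.

Definition op_instr (o : op) : instr :=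
  match o with
  | OSet i x => ISet (Negz i) x
  | OAdd i j l => IAdd (Negz i) (Negz j) (Negz l)
  | OSub i j l => ISub (Negz i) (Negz j) (Negz l)
  | OLoad i j => ILoad (Negz i) (Negz j)
  | OStore i j => IStore (Negz i) (Negz j)
  end.

Definition wf_op (o : op) : bool :=
  match o with
  | OSet i _ => (i < nregs)%N
  | OAdd i j l | OSub i j l => [&& i < nregs, j < nregs & l < nregs]%N
  | OLoad i j | OStore i j => (i < nregs)%N && (j < nregs)%N
  end.

(* [CWhile pre i j body] runs [pre] before every test of the condition
   "register [i] <= register [j]". *)
Inductive cmd :=
  | CBlk of seq op
  | CSeq of cmd & cmd
  | CIf of nat & nat & cmd & cmd
  | CWhile of seq op & nat & nat & cmd.

Fixpoint csize (c : cmd) : nat :=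
  match c with
  | CBlk l => size l
  | CSeq c1 c2 => (csize c1 + csize c2)%N
  | CIf _ _ c1 c2 => ((csize c1 + csize c2).+2)%N
  | CWhile pre _ _ c => ((size pre + csize c).+3)%N
  end.

Fixpoint wf_cmd (c : cmd) : bool :=
  match c with
  | CBlk l => all wf_op l
  | CSeq c1 c2 => wf_cmd c1 && wf_cmd c2
  | CIf i j c1 c2 => [&& i < nregs, j < nregs, wf_cmd c1 & wf_cmd c2]%N
  | CWhile pre i j c => [&& i < nregs, j < nregs, all wf_op pre & wf_cmd c]%N
  end.

(** Jump targets are absolute, hence the offset. A comparison of a register with itself always
    succeeds and serves as an unconditional jump. *)
Fixpoint compile (off : nat) (c : cmd) : seq instr :=
  match c with
  | CBlk l => map op_instr l
  | CSeq c1 c2 => compile off c1 ++ compile (off + csize c1)%N c2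
  | CIf i j c1 c2 =>
      IJle (Negz i) (Negz j) (off + (csize c2).+2)%N :: compile off.+1 c2 ++
      IJle (Negz i) (Negz i) (off + (csize c1 + csize c2).+2)%N ::
      compile (off + (csize c2).+2)%N c1
  | CWhile pre i j c =>
      map op_instr pre ++
      [:: IJle (Negz i) (Negz j) (off + (size pre).+2)%N;
          IJle (Negz i) (Negz i) (off + (size pre + csize c).+3)%N] ++
      compile (off + (size pre).+2)%N c ++ [:: IJle (Negz i) (Negz i) off]
  end.

Lemma size_compile off c : size (compile off c) = csize c.
Proof.
elim: c off => [l|c1 IH1 c2 IH2|i j c1 IH1 c2 IH2|pre i j c IH] off /=.
- by rewrite size_map.
- by rewrite size_cat IH1 IH2.
- by rewrite size_cat /= IH1 IH2; lia.
- by rewrite !size_cat /= size_cat /= size_map IH; lia.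
Qed.

Definition code_at (P : program) (off : nat) (l : seq instr) : Prop :=
  forall i, (i < size l)%N -> nth IHalt P (off + i) = nth IHalt l i.

Lemma code_at_cat P off l1 l2 : code_at P off (l1 ++ l2) ->
  code_at P off l1 /\ code_at P (off + size l1) l2.
Proof.
move=> h; split=> i il.
  by rewrite h ?nth_cat ?il // size_cat; lia.
by rewrite -addnA h ?size_cat ?ltn_add2l // nth_cat ltnNge leq_addr /= addKn.
Qed.

Lemma code_at_cons P off o l : code_at P off (o :: l) ->
  nth IHalt P off = o /\ code_at P off.+1 l.
Proof.
move=> h; split; first by have := h 0%N erefl; rewrite addn0.
by move=> i il; rewrite addSnnS h.
Qed.

Definition heap_addr (x : int) : bool := (0 <= x) || (x < - nregs%:Z).

Definition represents (rs : seq int) (hp m : int -> int) : Prop :=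
  [/\ size rs = nregs, forall i, (i < nregs)%N -> m (Negz i) = nth 0 rs i &
      forall x, heap_addr x -> m x = hp x].

(** Written by structural recursion so that [run] can execute straight-line code symbolically on the
    explicit register lists [regs]. *)
Fixpoint set_reg (rs : seq int) (i : nat) (x : int) : seq int :=
  match rs, i with
  | [::], _ => [::]
  | _ :: rs', 0 => x :: rs'
  | y :: rs', i'.+1 => y :: set_reg rs' i' x
  end.

Fixpoint get_reg (rs : seq int) (i : nat) : int :=
  match rs, i with
  | [::], _ => 0
  | y :: _, 0 => y
  | _ :: rs', i'.+1 => get_reg rs' i'
  end.

Lemma get_regE rs i : get_reg rs i = nth 0 rs i.
Proof. by elim: rs i => [|y rs IH] [|i] /=. Qed.

Lemma size_set_reg rs i x : size (set_reg rs i x) = size rs.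
Proof. by elim: rs i => [|y rs IH] [|i] //=; rewrite IH. Qed.

Lemma nth_set_reg rs i x j : (i < size rs)%N ->
  nth 0 (set_reg rs i x) j = if j == i then x else nth 0 rs j.
Proof. by elim: rs i j => [|y rs IH] [|i] [|j] //= /IH ->. Qed.

Lemma represents_set rs hp m i x : (i < nregs)%N -> represents rs hp m ->
  represents (set_reg rs i x) hp (upd m (Negz i) x).
Proof.
move=> ir [sz hr hh]; split=> [|j jr|y yh]; first by rewrite size_set_reg.
  by rewrite /upd nth_set_reg ?sz // -hr.
by rewrite /upd; case: eqP => [e|_]; [move: yh; rewrite /heap_addr; lia|apply: hh].
Qed.

Lemma represents_store rs hp m y x : heap_addr y -> represents rs hp m ->
  represents rs (upd hp y x) (upd m y x).
Proof.
move=> yh [sz hr hh]; split=> // [j jr|z zh].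
  rewrite /upd; case: eqP => [e|_]; last by apply: hr.
  by move: yh; rewrite /heap_addr; lia.
by rewrite /upd; case: eqP => // _; apply: hh.
Qed.

Fixpoint blk_wp (l : seq op) (rs : seq int) (hp : int -> int)
    (Q : seq int -> (int -> int) -> Prop) : Prop :=
  match l with
  | [::] => Q rs hp
  | OSet i x :: l' => blk_wp l' (set_reg rs i x) hp Q
  | OAdd i j k :: l' => blk_wp l' (set_reg rs i (get_reg rs j + get_reg rs k)) hp Q
  | OSub i j k :: l' => blk_wp l' (set_reg rs i (get_reg rs j - get_reg rs k)) hp Q
  | OLoad i j :: l' => heap_addr (get_reg rs j) /\
      blk_wp l' (set_reg rs i (hp (get_reg rs j))) hp Q
  | OStore i j :: l' => heap_addr (get_reg rs i) /\
      blk_wp l' rs (upd hp (get_reg rs i) (get_reg rs j)) Q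
  end.

Lemma exec_add P k1 k2 c : exec P (k1 + k2) c = exec P k2 (exec P k1 c).
Proof. by rewrite /exec addnC iterD. Qed.

Lemma blk_wp_exec l P off m rs hp Q : all wf_op l ->
  code_at P off (map op_instr l) -> represents rs hp m -> blk_wp l rs hp Q ->
  exists m' rs' hp', [/\ exec P (size l) (Config off m) = Config (off + size l) m',
    represents rs' hp' m' & Q rs' hp'].
Proof.
elim: l off m rs hp => [|o l IH] off m rs hp.
  by move=> _ _ rm q; exists m, rs, hp; split; rewrite ?addn0.
move=> /= /andP[wo wl] /code_at_cons [eo cl] rm.
have gr i : (i < nregs)%N -> get_reg rs i = m (Negz i).
  by case: rm => _ hr _ /hr; rewrite get_regE.
have gh x : heap_addr x -> hp x = m x by case: rm => _ _ hh /hh.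
have next m1 rs1 hp1 : step P (Config off m) = Config off.+1 m1 ->
    represents rs1 hp1 m1 -> blk_wp l rs1 hp1 Q ->
    exists m' rs' hp',
      [/\ exec P (size l).+1 (Config off m) = Config (off + (size l).+1) m',
          represents rs' hp' m' & Q rs' hp'].
  move=> e r1 q1; have [m' [rs' [hp' [e' r q]]]] := IH _ _ _ _ wl cl r1 q1.
  by exists m', rs', hp'; rewrite /exec iterSr e -/(exec P _ _) e' addnS.
case: o wo eo => [i x|i j k|i j k|i j|i j] /= wo eo.
- move=> q; apply: next q; first by rewrite /step /= eo.
  exact: represents_set.
- case/and3P: wo => wi wj wk q; rewrite (gr j) // (gr k) // in q.
  by apply: next q; [rewrite /step /= eo|apply: represents_set].
- case/and3P: wo => wi wj wk q; rewrite (gr j) // (gr k) // in q.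
  by apply: next q; [rewrite /step /= eo|apply: represents_set].
- case/andP: wo => wi wj [hj q]; rewrite gh // (gr j) // in q.
  by apply: next q; [rewrite /step /= eo|apply: represents_set].
- case/andP: wo => wi wj [hj q]; rewrite (gr i) // (gr j) // in q hj.
  by apply: next q; [rewrite /step /= eo|apply: represents_store].
Qed.

(** A total-correctness triple with step budget [t], independent of where the code is placed.
    Well-formedness is a premise inside, so it is checked once, by computation, for the whole
    program. *)
Definition wp (c : cmd) (t : nat) (rs : seq int) (hp : int -> int)
    (Q : seq int -> (int -> int) -> Prop) : Prop :=
  wf_cmd c -> forall P off, code_at P off (compile off c) ->
  forall m, represents rs hp m ->
  exists k m' rs' hp', [/\ (k <= t)%N,
    exec P k (Config off m) = Config (off + csize c) m',
    represents rs' hp' m' & Q rs' hp'].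

Lemma wp_blk l t rs hp Q : (size l <= t)%N -> blk_wp l rs hp Q ->
  wp (CBlk l) t rs hp Q.
Proof.
move=> lt h wl P off cP m rm.
have [m' [rs' [hp' [e r q]]]] := blk_wp_exec wl cP rm h.
by exists (size l), m', rs', hp'.
Qed.

Lemma wp_seq t1 t2 c1 c2 t rs hp Q : (t1 + t2 <= t)%N ->
  wp c1 t1 rs hp (fun rs' hp' => wp c2 t2 rs' hp' Q) ->
  wp (CSeq c1 c2) t rs hp Q.
Proof.
move=> tt h /= /andP[w1 w2] P off /code_at_cat; rewrite size_compile => -[cp1 cp2] m rm.
have [k1 [m1 [rs1 [hp1 [kt1 e1 r1 h2]]]]] := h w1 P off cp1 m rm.
have [k2 [m2 [rs2 [hp2 [kt2 e2 r2 q]]]]] := h2 w2 P _ cp2 m1 r1.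
exists (k1 + k2)%N, m2, rs2, hp2; split=> //; first by lia.
by rewrite exec_add e1 e2 addnA.
Qed.

Lemma exec_jump P off i tgt m :
  nth IHalt P off = IJle i i tgt -> exec P 1 (Config off m) = Config tgt m.
Proof. by move=> e; rewrite /exec /= /step /= e lexx. Qed.

Lemma wp_if t' i j c1 c2 t rs hp Q : (t' + 2 <= t)%N ->
  (get_reg rs i <= get_reg rs j -> wp c1 t' rs hp Q) ->
  (get_reg rs j < get_reg rs i -> wp c2 t' rs hp Q) ->
  wp (CIf i j c1 c2) t rs hp Q.
Proof.
move=> tt h1 h2 /= /and4P[wi wj w1 w2] P off /code_at_cons [eo].
move=> /code_at_cat [cp2] /code_at_cons; rewrite size_compile => -[ej cp1] m rm.
have gr k : (k < nregs)%N -> get_reg rs k = m (Negz k).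
  by case: rm => _ hr _ /hr; rewrite get_regE.
rewrite !gr // in h1 h2; case: (leP (m (Negz i)) (m (Negz j))) => ij.
  have E1 : ((off.+1 + csize c2).+1 = off + (csize c2).+2)%N by lia.
  rewrite E1 in cp1.
  have [k [m' [rs' [hp' [kt e r q]]]]] := h1 ij w1 P _ cp1 m rm.
  exists (1 + k)%N, m', rs', hp'; split=> //; first by lia.
  have e1 : exec P 1 (Config off m) = Config (off + (csize c2).+2) m.
    by rewrite /exec /= /step /= eo ij.
  by rewrite exec_add e1 e; congr Config => /=; lia.
have [k [m' [rs' [hp' [kt e r q]]]]] := h2 ij w2 P _ cp2 m rm.
exists (1 + k + 1)%N, m', rs', hp'; split=> //; first by lia.
rewrite !exec_add.
have -> : exec P 1 (Config off m) = Config off.+1 m.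
  by rewrite /exec /= /step /= eo leNgt ij.
by rewrite e (exec_jump _ ej).
Qed.

(** The index of [I] bounds the iterations left. An iteration pays for [pre], the body and two
    jumps; the last [+ 2] is the failing test and the exit jump. *)
Lemma wp_while (I : nat -> seq int -> (int -> int) -> Prop) t k0 pre i j c T rs0 hp0 Q :
  (k0 * (size pre + t + 2) + (size pre + 2) <= T)%N ->
  (forall k rs hp, I k rs hp ->
    blk_wp pre rs hp (fun rs' hp' =>
      (get_reg rs' i <= get_reg rs' j ->
         exists2 k', (k' < k)%N & wp c t rs' hp' (I k')) /\
      (get_reg rs' j < get_reg rs' i -> Q rs' hp'))) ->
  I k0 rs0 hp0 ->
  wp (CWhile pre i j c) T rs0 hp0 Q.
Proof.
move=> kT hI I0 /= /and4P[wi wj wpre wc] P off /code_at_cat.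
rewrite size_map => -[cpre] /= /code_at_cons [ej] /code_at_cons [ee].
move=> /code_at_cat; rewrite size_compile => -[cc] /code_at_cons [eb _] m rm.
have E1 : ((off + size pre).+2 = off + (size pre).+2)%N by lia.
rewrite E1 in cc eb.
elim/ltn_ind: k0 T kT rs0 hp0 I0 m rm => k IH T kT rs hp Ik m rm.
have [m1 [rs1 [hp1 [e1 r1 [q1 q2]]]]] := blk_wp_exec wpre cpre rm (hI _ _ _ Ik).
have gr l : (l < nregs)%N -> get_reg rs1 l = m1 (Negz l).
  by case: r1 => _ hr _ /hr; rewrite get_regE.
rewrite !gr // in q1 q2; case: (leP (m1 (Negz i)) (m1 (Negz j))) => ij.
  have [k' kk' w] := q1 ij.
  have [k2 [m2 [rs2 [hp2 [kt2 e2 r2 I2]]]]] := w wc P _ cc m1 r1.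
  have [k3 [m3 [rs3 [hp3 [kt3 e3 r3 q3]]]]] :=
    IH k' kk' _ (leqnn _) rs2 hp2 I2 m2 r2.
  exists (size pre + 1 + k2 + 1 + k3)%N, m3, rs3, hp3; split=> //.
    apply: leq_trans kT.
    apply: leq_trans (_ : k'.+1 * (size pre + t + 2) + (size pre + 2) <= _)%N.
      by rewrite mulSn; lia.
    by rewrite leq_add2r leq_mul2r kk' orbT.
  rewrite !exec_add e1.
  have -> : exec P 1 (Config (off + size pre) m1) = Config (off + (size pre).+2) m1.
    by rewrite /exec /= /step /= ej ij.
  by rewrite e2 (exec_jump _ eb) e3.
exists (size pre + 1 + 1)%N, m1, rs1, hp1; split=> //; [by lia| |exact: q2].
rewrite !exec_add e1.
have -> : exec P 1 (Config (off + size pre) m1) = Config (off + size pre).+1 m1.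
  by rewrite /exec /= /step /= ej leNgt ij.
by rewrite (exec_jump _ ee).
Qed.

(** * Digit vectors *)

(** Used in two bases for the same vector of slots: base [n] gives the code of a state, base 2 the
    number of players still to be seated. *)
Definition wsum (W m : nat) (h : nat -> nat) : nat := (\sum_(i < m) h i * W ^ i)%N.

Notation repunit W m := (wsum W m (fun=> 1%N)).

Lemma wsumS W m h : wsum W m.+1 h = (wsum W m h + h m * W ^ m)%N.
Proof. by rewrite /wsum big_ord_recr. Qed.

Lemma wsumD W m h1 h2 :
  wsum W m (fun i => h1 i + h2 i)%N = (wsum W m h1 + wsum W m h2)%N.
Proof. by rewrite /wsum -big_split; apply: eq_bigr => i _; rewrite mulnDl. Qed.

Lemma wsumM W m a h : wsum W m (fun i => a * h i)%N = (a * wsum W m h)%N.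
Proof. by rewrite /wsum big_distrr; apply: eq_bigr => i _; rewrite /= mulnA. Qed.

Lemma eq_wsum W m h1 h2 : (forall i, (i < m)%N -> h1 i = h2 i) ->
  wsum W m h1 = wsum W m h2.
Proof. by move=> e; apply: eq_bigr => i _; rewrite e. Qed.

Lemma wsum_ltn W m j : (j <= m)%N -> wsum W m (fun i => i < j)%N = repunit W j.
Proof.
move=> jm; elim: m jm => [|m IH]; first by rewrite leqn0 => /eqP ->; rewrite /wsum !big_ord0.
rewrite leq_eqVlt => /orP[/eqP -> |jm]; first by apply: eq_wsum => i ->.
by rewrite wsumS IH // ltnNge -ltnS jm /= mul0n addn0.
Qed.

Lemma wsum_eq W m j : (j < m)%N -> wsum W m (fun i => i == j) = (W ^ j)%N.
Proof.
move=> jm; have := wsum_ltn W jm; rewrite wsumS -(wsum_ltn W (ltnW jm)).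
rewrite (@eq_wsum _ _ _ (fun i => (i < j)%N + (i == j))%N) => [|i _]; last by lia.
by rewrite wsumD mul1n => /addnI.
Qed.

Lemma repunitE W m : (0 < W)%N -> (W.-1 * repunit W m + 1 = W ^ m)%N.
Proof.
move=> W0; elim: m => [|m IH]; first by rewrite /wsum big_ord0 muln0.
by rewrite wsumS mulnDr addnAC IH mul1n expnS -mulSn prednK.
Qed.

Lemma repunit2 m : (repunit 2 m = 2 ^ m - 1)%N.
Proof. by have := @repunitE 2 m erefl; lia. Qed.

Lemma wsum_lt W m h : (forall i, (i < m)%N -> (h i < W)%N) -> (wsum W m h < W ^ m)%N.
Proof.
elim: m => [|m IH] hW; first by rewrite /wsum big_ord0.
rewrite wsumS expnS; have := IH (fun i im => hW i (ltnW im)); have := hW m (leqnn _).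
by nia.
Qed.

Lemma wsum_inj W m h1 h2 : (forall i, (i < m)%N -> (h1 i < W)%N) ->
  (forall i, (i < m)%N -> (h2 i < W)%N) -> wsum W m h1 = wsum W m h2 ->
  forall i, (i < m)%N -> h1 i = h2 i.
Proof.
elim: m => // m IH l1 l2; rewrite !wsumS => e i.
have b1 := wsum_lt (fun i im => l1 i (ltnW im)).
have b2 := wsum_lt (fun i im => l2 i (ltnW im)).
have em : h1 m = h2 m.
  have := congr1 (fun x => x %/ W ^ m)%N e; rewrite /= ![(wsum _ _ _ + _)%N]addnC.
  have Wm : (0 < W ^ m)%N by apply: leq_ltn_trans b1.
  by rewrite !divnMDl // !divn_small // !addn0.
rewrite ltnS leq_eqVlt => /orP[/eqP -> //|im].
apply: IH im => [j jm|j jm|]; [exact: l1 (ltnW jm)|exact: l2 (ltnW jm)|].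
by move: e; rewrite em => /addIn.
Qed.

Lemma wsum_ge W m h i : (0 < W)%N -> (i < m)%N -> (h i * W ^ i <= wsum W m h)%N.
Proof. by move=> W0 im; rewrite /wsum (bigD1 (Ordinal im)) //= leq_addr. Qed.

(** In base [n] this says that taking a slot of height [j] lowers the code by a constant depending
    only on [j], which the program can tabulate. *)
Lemma wsum_slot W m h h' j : (j < m)%N ->
  (forall i, h' i + (i == j) = h i + (i < j))%N ->
  (wsum W m h' + W ^ j = wsum W m h + repunit W j)%N.
Proof.
move=> jm e; rewrite -(wsum_eq W jm) -(wsum_ltn W (ltnW jm)) -!wsumD.
by apply: eq_wsum => i _; apply: e.
Qed.

Definition carry (j : nat) (h : nat -> nat) (i : nat) : nat :=
  if (i < j)%N then 0%N else (h i + (i == j))%N.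

(** The digit value [n1] is independent of the base: with [n1 = n - 1], base [n] shows that the code
    grows by 1, and base 2 tracks the number of players. *)
Lemma wsum_carry W m h j n1 : (j < m)%N -> (forall i, (i < j)%N -> h i = n1) ->
  (wsum W m (carry j h) + n1 * repunit W j = wsum W m h + W ^ j)%N.
Proof.
move=> jm hj; rewrite -(wsum_eq W jm) -(wsum_ltn W (ltnW jm)) -wsumM -!wsumD.
apply: eq_wsum => i _; rewrite /carry; case: ltnP => ij; last by lia.
by rewrite (hj i ij); lia.
Qed.

Definition best_play sc k h x :=
  play sc k h x /\ (forall y, play sc k h y -> y <= x).

(** * The program *)

(* [w], [R] and [c] hold three times n ^ j, 1 + n + ... + n ^ (j-1) and the current
   code, 3 being the stride of the interleaved arrays below; [pw] is 2 ^ j, [vb]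
   ends up pointing to the threshold, [m] is the number of players left, [q] is
   (n-1) * 2 ^ j while carrying and n * (n-1) afterwards, [fl] tells whether [bst]
   already holds a candidate, [u] and [b] locate row 2 ^ j - 1 of the round-(j+1)
   value table.  Registers 1, 2 and 23 hold the constants 1, 3 and 0. *)
Definition regs (n n2 cnt t w R pw po vb nm1 c m q acc fl bst u b x d cd : int) : seq int :=
  [:: n; 1; 3%:Z; n2; cnt; t; w; R; pw; po; vb; nm1; c; m; q; acc; fl; bst;
      u; b; x; d; cd; 0].

(** Multiplication of register 6 by [n] through repeated addition, the machine having no product. *)
Definition mul_cmd : cmd :=
  CWhile [:: OAdd 5 4 1] 5 0 (CBlk [:: OAdd 20 20 6; OAdd 4 4 1]).

(** The number of rounds is not part of the input; doubling [pw] until it reaches [n] makes the loop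
    run once per round. *)
Definition setup_cmd : cmd :=
  CWhile [:: OAdd 5 8 1] 5 0
    (CSeq (CBlk [:: OSub 5 6 7; OStore 9 5; OAdd 7 7 6; OSub 9 9 2; OAdd 8 8 8;
                    OAdd 10 10 3; OSet 4 0; OSet 20 0])
    (CSeq mul_cmd (CBlk [:: OAdd 6 20 23]))).

Definition carry_cmd : cmd :=
  CWhile [:: OLoad 21 9] 11 21
    (CBlk [:: OStore 9 23; OSub 13 13 14; OAdd 14 14 14; OAdd 8 8 8; OSub 9 9 2]).

(** The score of the current player at this height is his value against [n.-1] plus the running sum
    [acc]; the optimum of the remaining state is read from the table. *)
Definition candidate_cmd : cmd :=
  CSeq (CBlk [:: OAdd 20 19 14; OAdd 20 20 4; OLoad 22 20; OAdd 22 22 15;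
                 OLoad 20 9; OSub 20 20 12; OSet 5 (-102); OAdd 20 20 5;
                 OLoad 20 20; OAdd 22 22 20])
       (CIf 16 23 (CBlk [:: OAdd 17 22 23; OSet 16 1])
          (CIf 17 22 (CBlk [:: OAdd 17 22 23]) (CBlk [::]))).

(** Extending [acc] by one summand of [score] per height keeps the work per height constant. The row
    offset [u] is [(2 ^ j - 1) * n], updated by doubling and adding [n]. *)
Definition choose_cmd : cmd :=
  CWhile [:: OAdd 5 8 1] 5 0
    (CSeq (CBlk [:: OSub 20 9 1; OLoad 21 20])
    (CSeq (CIf 1 21 candidate_cmd (CBlk [::]))
          (CBlk [:: OAdd 20 19 18; OAdd 5 20 4; OLoad 5 5; OAdd 15 15 5;
                    OAdd 20 20 11; OLoad 20 20; OSub 15 15 20;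
                    OAdd 18 18 18; OAdd 18 18 0; OAdd 8 8 8; OAdd 19 19 3;
                    OSub 9 9 2]))).

(** The pass ends at code [repunit n n'], that of one open slot of each height, the state left once
    the champion is seated. *)
Definition table_cmd : cmd :=
  CWhile [:: OAdd 5 12 1] 5 7
    (CSeq (CBlk [:: OSet 9 (-101); OSet 8 1; OAdd 14 11 23])
    (CSeq carry_cmd
    (CSeq (CBlk [:: OAdd 21 21 1; OStore 9 21; OAdd 13 13 8; OAdd 12 12 2;
                    OSet 15 0; OSet 16 0; OSet 17 0; OSet 8 1; OSet 18 0;
                    OAdd 19 0 1; OSet 9 (-100); OSub 4 13 1; OSub 14 3 0])
    (CSeq choose_cmd
          (CBlk [:: OSet 5 (-102); OSub 5 5 12; OStore 5 17]))))).

Definition main_cmd : cmd :=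
  CSeq (CBlk [:: OLoad 0 23; OSet 1 1; OSet 2 3; OSub 11 0 1; OAdd 6 0 23])
  (CSeq mul_cmd
  (CSeq (CBlk [:: OAdd 3 20 23; OSet 6 3; OSet 8 1; OSet 9 (-100); OAdd 10 0 1])
  (CSeq setup_cmd
  (CSeq table_cmd
  (CSeq (CBlk [:: OLoad 20 10; OSet 5 (-102); OSub 5 5 7; OLoad 5 5])
        (CIf 20 5 (CBlk [:: OStore 23 1]) (CBlk [:: OStore 23 23]))))))).

Ltac run := cbv beta iota delta [blk_wp set_reg get_reg regs].
Ltac heap := by rewrite /heap_addr /nregs; lia.
Ltac regs_eq := rewrite /regs; repeat (apply: (f_equal2 (@cons int))); try done; try lia.

Lemma wp_mul T N n2 t w R pw po vb nm1 c m q acc fl bst u b d cd hp Q :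
  (5 * N + 3 <= T)%N ->
  Q (regs N%:Z n2 N%:Z (N%:Z + 1) w R pw po vb nm1 c m q acc fl bst u b (N%:Z * w) d cd) hp ->
  wp mul_cmd T (regs N%:Z n2 0 t w R pw po vb nm1 c m q acc fl bst u b 0 d cd) hp Q.
Proof.
move=> NT q0.
apply: (@wp_while (fun k rs hp' => hp' = hp /\ exists i t, (i + k = N)%N /\
  rs = regs N%:Z n2 i%:Z t w R pw po vb nm1 c m q acc fl bst u b (i%:Z * w) d cd) 2 N).
- by rewrite /=; lia.
- move=> k rs _ [-> [i [t' [ik ->]]]]; run; split=> h.
    exists k.-1; first by lia.
    apply: wp_blk; first by []; run; split=> //; exists i.+1, (i%:Z + 1); split; first by lia.
    by regs_eq.
  have -> : i = N by lia.
  exact: q0.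
- by split=> //; exists 0%N, t; split=> //; regs_eq.
Qed.

(** * Correctness and running time of the program *)

Section Table.

Variables (n' : nat) (v : nat -> nat -> nat -> int) (V : int) (inp : nat -> int).
Let N := (2 ^ n')%N.
Hypothesis inp0 : inp 0%N = N%:Z.
Hypothesis inp_v : forall r a b, (r < n')%N -> (a < N)%N -> (b < N)%N ->
  inp (1 + N + r * (N * N) + a * N + b)%N = v a b r.+1.
Hypothesis inp_V : inp (1 + N + n' * (N * N))%N = V.

Local Notation sc := (score v N).
Local Notation code := (wsum N n').
Local Notation mass := (wsum 2 n').

Let N0 : (0 < N)%N. Proof. by rewrite expn_gt0. Qed.

Definition heap0 (x : int) : int := if x is Posz k then inp k else 0.

(* Interleaved arrays: offsets [n ^ j - (1 + ... + n ^ (j-1))] subtracted from a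
   code when a slot of height [j] is taken, digits of the current code, and the
   optimum table. *)
Definition Oaddr (j : nat) : int := - (100 + 3 * j)%N%:Z.
Definition Daddr (j : nat) : int := - (101 + 3 * j)%N%:Z.
Definition Taddr (c : nat) : int := - (102 + 3 * c)%N%:Z.

Definition offsets_ok (j : nat) (hp : int -> int) : Prop :=
  (forall k, hp (Posz k) = inp k) /\
  forall i, (i < j)%N -> hp (Oaddr i) = 3 * (N ^ i)%N%:Z - 3 * (repunit N i)%:Z.

Lemma wp_setup T R0 hp Q n2 t nm1 c m q acc fl bst u b x d cd cnt :
  (n' * (5 * N + 20) + 3 <= T)%N -> n2 = (N * N)%N%:Z -> R0 = 0 ->
  hp =1 heap0 ->
  (forall hp' t x cnt w pw po, offsets_ok n' hp' ->
     (forall j, hp' (Daddr j) = 0) -> (forall j, hp' (Taddr j) = 0) ->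
     Q (regs N%:Z n2 cnt t w (3 * (repunit N n')%:Z) pw po
        (1 + N + n' * (N * N))%N%:Z nm1 c m q acc fl bst u b x d cd) hp') ->
  wp setup_cmd T (regs N%:Z n2 cnt t 3 R0 1 (-100) (N%:Z + 1) nm1 c m q acc fl bst
     u b x d cd) hp Q.
Proof.
move=> NT En2 -> hp0 q0.
apply: (@wp_while (fun k rs hp' => exists j t x cnt, [/\ (j + k = n')%N,
  rs = regs N%:Z n2 cnt t (3 * (N ^ j)%N%:Z) (3 * (repunit N j)%:Z) (2 ^ j)%N%:Z
     (Oaddr j) (1 + N + j * (N * N))%N%:Z nm1 c m q acc fl bst u b x d cd,
  offsets_ok j hp', forall i, hp' (Daddr i) = 0 & forall i, hp' (Taddr i) = 0])
  (5 * N + 14)%N n').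
- by rewrite /=; lia.
- move=> k rs hp' [j [t' [x' [cnt' [jk -> [oI oO] dz tz]]]]]; run; split=> h.
    have jn : (j < n')%N.
      by rewrite -(@ltn_exp2l 2) // -/N; lia.
    exists k.-1; first by lia.
    apply: (@wp_seq 8 (5 * N + 5)); first by lia.
    apply: wp_blk; first by []; run.
    split; first by rewrite /Oaddr; heap.
    apply: (@wp_seq (5 * N + 3) 1); first by lia.
    apply: wp_mul; first by lia.
    apply: wp_blk; first by []; run.
    exists j.+1; do 3!eexists; split.
    + by lia.
    + rewrite wsumS /Oaddr; regs_eq; rewrite ?expnS; lia.
    + split=> [i|i ij]; rewrite /upd.
        by case: eqP => // ; rewrite /Oaddr; lia.
      case: eqP => [e|e].
        have -> : i = j by move: e; rewrite /Oaddr; lia.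
        by [].
      apply: oO; have : i != j by apply/eqP => ij'; apply: e; rewrite ij'.
      by lia.
    + by move=> i; rewrite /upd; case: eqP => //; rewrite /Oaddr /Daddr; lia.
    + by move=> i; rewrite /upd; case: eqP => //; rewrite /Oaddr /Taddr; lia.
  have jn : j = n'.
    have : (n' <= j)%N; last by lia.
    by rewrite -(@leq_exp2l 2) // -/N; lia.
  by rewrite jn in oO *; apply: q0.
- exists 0%N, t, x, cnt; split=> //.
  by rewrite expn0 /wsum big_ord0; regs_eq.
Qed.

Lemma upd_same (hp : int -> int) a x : upd hp a x a = x.
Proof. by rewrite /upd eqxx. Qed.

Lemma upd_other (hp : int -> int) a x y : y <> a -> upd hp a x y = hp y.
Proof. by rewrite /upd => /eqP/negPf ->. Qed.

Definition digits_ok (h : nat -> nat) (hp : int -> int) : Prop :=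
  forall i, (i < n')%N -> hp (Daddr i) = (h i)%:Z.

Lemma offsets_ok_upd j hp a x : a < 0 -> (forall i, a <> Oaddr i) ->
  offsets_ok j hp -> offsets_ok j (upd hp a x).
Proof.
move=> a0 aO [oI oO]; split=> [k|i ij].
  by rewrite upd_other //; lia.
by rewrite upd_other ?oO //; apply/eqP; rewrite eq_sym; apply/eqP.
Qed.

Lemma wp_carry T h hp Q n2 cnt t w R vb c acc fl bst u b x d cd :
  (8 * n' + 3 <= T)%N ->
  (forall i, (i < n')%N -> (h i < N)%N) -> (code h < repunit N n')%N ->
  offsets_ok n' hp -> digits_ok h hp ->
  (forall j hp' q, (j < n')%N -> (forall i, (i < j)%N -> h i = N.-1) ->
     (h j < N.-1)%N -> offsets_ok n' hp' ->
     digits_ok (fun i => if (i < j)%N then 0%N else h i) hp' ->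
     (forall k, hp' (Taddr k) = hp (Taddr k)) ->
     Q (regs N%:Z n2 cnt t w R (2 ^ j)%N%:Z (Daddr j) vb (N%:Z - 1) c
        ((mass h)%:Z - (N%:Z - 1) * ((2 ^ j)%N%:Z - 1)) q acc fl bst u b x (h j)%:Z cd) hp') ->
  wp carry_cmd T (regs N%:Z n2 cnt t w R 1 (-101) vb (N%:Z - 1) c (mass h)%:Z
     (N%:Z - 1) acc fl bst u b x d cd) hp Q.
Proof.
move=> nT hN cR oh dh q0.
apply: (@wp_while (fun k rs hp' => exists j d, [/\
  rs = regs N%:Z n2 cnt t w R (2 ^ j)%N%:Z (Daddr j) vb (N%:Z - 1) c
        ((mass h)%:Z - (N%:Z - 1) * ((2 ^ j)%N%:Z - 1)) ((N%:Z - 1) * (2 ^ j)%N%:Z)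
        acc fl bst u b x d cd, (j + k = n')%N, forall i, (i < j)%N -> h i = N.-1,
  offsets_ok n' hp' /\ digits_ok (fun i => if (i < j)%N then 0%N else h i) hp' &
     (forall k, hp' (Taddr k) = hp (Taddr k))]) 5 n').
- by rewrite /=; lia.
- move=> k rs hp' [j [d' [-> jk hj [oh' dh'] th']]]; run.
  have jn : (j < n')%N.
    (* If all digits were [n - 1], the code would be [(n - 1) * repunit], at least [repunit]; so the
       carry stops at some digit. *)
    case: (ltnP j n') => // nj; have jn : j = n' by lia.
    have R0 : (1 <= repunit N n')%N by lia.
    have n0 : (0 < n')%N by case: (n') R0 => //; rewrite /wsum big_ord0.
    have N2 : (2 <= N)%N by rewrite -{1}(expn1 2) leq_exp2l.
    have e : code h = (N.-1 * repunit N n')%N.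
      by rewrite -wsumM; apply: eq_wsum => i; rewrite muln1 -jn => /hj.
    by nia.
  have dj := dh' j jn; rewrite /= ltnn in dj.
  split; first by rewrite /Daddr; heap.
  rewrite dj; split=> hh.
    exists k.-1; first by lia.
    apply: wp_blk; first by []; run; split; first by rewrite /Daddr; heap.
    exists j.+1; eexists; split.
    + rewrite /Daddr expnS; regs_eq.
    + by lia.
    + move=> i; rewrite ltnS leq_eqVlt => /orP[/eqP -> |/hj //].
      by have := hN j jn; lia.
    + split; first by apply: offsets_ok_upd => // i; rewrite /Daddr /Oaddr; lia.
      move=> i ii; have [-> |ij] := eqVneq i j; first by rewrite upd_same ltnSn.
      rewrite upd_other ?dh' //; last by rewrite /Daddr; lia.
      by have -> : (i < j.+1)%N = (i < j)%N by lia.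
    + by move=> i; rewrite upd_other // /Taddr /Daddr; lia.
  by apply: q0 => //; lia.
- exists 0%N, d; split=> //; rewrite expn0 /Daddr; regs_eq.
Qed.

Definition supported (h : nat -> nat) : Prop := forall i, (n' <= i)%N -> h i = 0%N.

(** The pass also visits codes of states with more than [N.-1] players; nothing is claimed about
    their entries, and states with at most [N.-1] players never lead to them. *)
Definition table_ok (c : nat) (hp : int -> int) : Prop :=
  forall h, supported h -> (mass h <= N.-1)%N -> (code h < c)%N ->
    best_play sc (mass h) h (hp (Taddr (code h))).

Section Choose.

Variables (h : nat -> nat) (k : nat) (hp : int -> int).
Hypotheses (sh : supported h) (mh : mass h = k.+1).
Hypotheses (oh : offsets_ok n' hp) (dh : digits_ok h hp) (th : table_ok (code h) hp).

Let take_slot (j i : nat) : nat := (h i - (i == j) + (i < j))%N.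

Let take_slotP j : (0 < h j)%N ->
  forall i, (take_slot j i + (i == j) = h i + (i < j))%N.
Proof. by move=> hj i; rewrite /take_slot; case: eqP => [->|_] /=; lia. Qed.

Let code_slot j : (j < n')%N -> (0 < h j)%N ->
  (code (take_slot j) + N ^ j = code h + repunit N j)%N.
Proof. by move=> jn hj; apply: wsum_slot => //; apply: take_slotP. Qed.

(** The next state has one player fewer and, since [repunit N j < N ^ j], a strictly smaller code:
    its entry is already final. *)
Let best_slot j : (j < n')%N -> (0 < h j)%N -> (k.+1 <= N.-1)%N ->
  best_play sc k (take_slot j) (hp (Taddr (code (take_slot j)))).
Proof.
move=> jn hj kN.
have mk : mass (take_slot j) = k.
  have := wsum_slot 2 jn (take_slotP hj); rewrite mh repunit2.
  by have := expn_gt0 2 j; lia.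
have N2 : (2 <= N)%N by lia.
have := th (h := take_slot j); rewrite mk; apply.
- by move=> i ni; rewrite /take_slot (sh ni); lia.
- by lia.
- by have := code_slot jn hj; have := repunitE j N0; nia.
Qed.

(** Values may be negative, so no initial number can stand for the absence of a candidate; hence the
    flag. *)
Definition chosen (j : nat) (fl bst : int) : Prop :=
  (fl = 0 /\ forall i, (i < j)%N -> h i = 0%N) \/
  [/\ fl = 1, play sc k.+1 h bst &
      forall i h' y, (i < j)%N -> (0 < h i)%N ->
        (forall l, (h' l + (l == i) = h l + (l < i))%N) ->
        play sc k h' y -> sc k i + y <= bst].

Lemma chosen_skip j fl bst : h j = 0%N -> chosen j fl bst -> chosen j.+1 fl bst.
Proof.
move=> hj [[-> h0]|[-> pb ub]]; [left|right]; split=> // i.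
  by rewrite ltnS leq_eqVlt => /orP[/eqP ->|/h0].
move=> h' y; rewrite ltnS leq_eqVlt => /orP[/eqP ->|]; [by rewrite hj|exact: ub].
Qed.

Lemma chosen_take j fl bst cd : (j < n')%N -> (0 < h j)%N -> (k.+1 <= N.-1)%N ->
  cd = sc k j + hp (Taddr (code (take_slot j))) ->
  chosen j fl bst ->
  [/\ fl <= 0 -> chosen j.+1 1 cd,
      0 < fl -> bst <= cd -> chosen j.+1 fl cd &
      0 < fl -> cd < bst -> chosen j.+1 fl bst].
Proof.
move=> jn hj kN Ecd; have [pj uj] := best_slot jn hj kN.
have pcd : play sc k.+1 h cd by rewrite Ecd; apply: PlayTake pj => //; apply: take_slotP.
have ucd h' y : (forall l, (h' l + (l == j) = h l + (l < j))%N) ->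
    play sc k h' y -> sc k j + y <= cd.
  move=> e py; rewrite Ecd lerD2l; apply: uj; apply: play_ext py => i.
  by have := take_slotP hj i; rewrite -(e i) => /addIn.
case=> [[-> h0]|[-> pb ub]]; split=> // f1.
- right; split=> // i h' y; rewrite ltnS leq_eqVlt => /orP[/eqP -> _|ij]; first exact: ucd.
  by rewrite (h0 i ij).
- move=> bc; right; split=> // i h' y; rewrite ltnS leq_eqVlt => /orP[/eqP -> _|ij hi e py].
    exact: ucd.
  exact: le_trans (ub _ _ _ ij hi e py) bc.
- move=> bc; right; split=> // i h' y; rewrite ltnS leq_eqVlt => /orP[/eqP -> _ e py|ij hi e py].
    exact: le_trans (ucd _ _ e py) (ltW bc).
  exact: ub ij hi e py.
Qed.

Definition partial_score (j : nat) : int :=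
  \sum_(r < j) (v (2 ^ r - 1)%N k r.+1 - v (2 ^ r - 1)%N N.-1 r.+1).

(** For states with too many players the values loaded are meaningless, but every address stays
    legal. Execution and cost are thus unconditional, and only optimality is guarded by
    [k.+1 <= N.-1]. *)
Lemma wp_candidate j T Q cnt n2 t w R pw vb nm1 m acc fl bst u x d cd :
  (17 <= T)%N -> cnt = k%:Z -> (j < n')%N -> (0 < h j)%N ->
  ((k.+1 <= N.-1)%N -> acc = partial_score j /\ chosen j fl bst) ->
  (forall t x cd fl bst, ((k.+1 <= N.-1)%N -> chosen j.+1 fl bst) ->
     Q (regs N%:Z n2 cnt t w R pw (Oaddr j) vb nm1 (3 * (code h)%:Z) m
        ((N * N)%N%:Z - N%:Z) acc fl bst u (1 + N + j * (N * N))%N%:Z x d cd) hp) ->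
  wp candidate_cmd T
    (regs N%:Z n2 cnt t w R pw (Oaddr j) vb nm1 (3 * (code h)%:Z) m
      ((N * N)%N%:Z - N%:Z) acc fl bst u (1 + N + j * (N * N))%N%:Z x d cd) hp Q.
Proof.
move=> T17 -> jn hj hval q0; have [oI oO] := oh.
have cs := code_slot jn hj.
have NN : (N.-1 * N = N * N - N)%N by rewrite -subn1 mulnBl mul1n.
have NN' : (N <= N * N)%N by rewrite leq_pmulr.
apply: (@wp_seq 10 7); first by []; apply: wp_blk; first by []; run.
have -> : (1 + N + j * (N * N))%N%:Z + ((N * N)%N%:Z - N%:Z) + k%:Z =
          (1 + N + j * (N * N) + N.-1 * N + k)%N%:Z by rewrite NN; lia.
split; first by heap.
split; first by rewrite /Oaddr; heap.
rewrite oO // oI.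
have -> : 3 * (N ^ j)%N%:Z - 3 * (repunit N j)%:Z - 3 * (code h)%:Z + -102 =
          Taddr (code (take_slot j)) by rewrite /Taddr; lia.
split; first by rewrite /Taddr; heap.
set cd' := _ + _ + hp _.
have up : (k.+1 <= N.-1)%N ->
  [/\ fl <= 0 -> chosen j.+1 1 cd',
      0 < fl -> bst <= cd' -> chosen j.+1 fl cd' &
      0 < fl -> cd' < bst -> chosen j.+1 fl bst].
  move=> kN; have [ea ch] := hval kN; apply: chosen_take => //.
  rewrite /cd' ea inp_v //; try lia.
  by rewrite /score ifN //; lia.
apply: (@wp_if 5); first by []; run => f0.
  apply: wp_blk; first by []; run; rewrite addr0; apply: q0 => kN.
  by have [u1 _ _] := up kN; apply: u1.
apply: (@wp_if 3); first by []; run => f1.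
  apply: wp_blk; first by []; run; rewrite addr0; apply: q0 => kN.
  by have [_ u2 _] := up kN; apply: u2.
apply: wp_blk; first by []; run; apply: q0 => kN.
by have [_ _ u3] := up kN; apply: u3.
Qed.

Lemma wp_choose T Q cnt n2 t w R vb m x d cd :
  (36 * n' + 3 <= T)%N -> cnt = k%:Z -> n2 = (N * N)%N%:Z ->
  (forall t pw po acc fl bst u b x d cd,
     ((k.+1 <= N.-1)%N -> best_play sc k.+1 h bst) ->
     Q (regs N%:Z n2 cnt t w R pw po vb (N%:Z - 1) (3 * (code h)%:Z) m
        ((N * N)%N%:Z - N%:Z) acc fl bst u b x d cd) hp) ->
  wp choose_cmd T
    (regs N%:Z n2 cnt t w R 1 (-100) vb (N%:Z - 1) (3 * (code h)%:Z) m
      ((N * N)%N%:Z - N%:Z) 0 0 0 0 (N%:Z + 1) x d cd) hp Q.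
Proof.
move=> nT Ec En q0; have [oI oO] := oh.
have NN : (N.-1 * N = N * N - N)%N by rewrite -subn1 mulnBl mul1n.
have NN' : (N <= N * N)%N by rewrite leq_pmulr.
apply: (@wp_while (fun l rs hp' => hp' = hp /\ exists j t acc fl bst x d cd, [/\
  rs = regs N%:Z n2 cnt t w R (2 ^ j)%N%:Z (Oaddr j) vb (N%:Z - 1) (3 * (code h)%:Z) m
      ((N * N)%N%:Z - N%:Z) acc fl bst ((2 ^ j - 1) * N)%N%:Z
      (1 + N + j * (N * N))%N%:Z x d cd, (j + l = n')%N &
  (k.+1 <= N.-1)%N -> acc = partial_score j /\ chosen j fl bst]) 33 n').
- by rewrite /=; lia.
- move=> l rs _ [-> [j [t' [acc [fl [bst [x' [d' [cd' [-> jl hval]]]]]]]]]]; run.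
  have p0 : (0 < 2 ^ j)%N by rewrite expn_gt0.
  split=> hh.
    have jn : (j < n')%N by rewrite -(@ltn_exp2l 2) // -/N; lia.
    have jN : (2 ^ j < N)%N by rewrite ltn_exp2l.
    exists l.-1; first by lia.
    apply: (@wp_seq 2 31); first by []; apply: wp_blk; first by []; run.
    have -> : Oaddr j - 1 = Daddr j by rewrite /Oaddr /Daddr; lia.
    split; first by rewrite /Daddr; heap.
    rewrite dh //; apply: (@wp_seq 19 12); first by [].
    (* The update at the end of the body is shared by the case with a slot of height [j] and the
       case without. *)
    suff next t0 x0 cd0 fl0 bst0 :
      ((k.+1 <= N.-1)%N -> chosen j.+1 fl0 bst0) ->
      wp (CBlk [:: OAdd 20 19 18; OAdd 5 20 4; OLoad 5 5; OAdd 15 15 5;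
                    OAdd 20 20 11; OLoad 20 20; OSub 15 15 20;
                    OAdd 18 18 18; OAdd 18 18 0; OAdd 8 8 8; OAdd 19 19 3;
                    OSub 9 9 2]) 12
       (regs N%:Z n2 cnt t0 w R (2 ^ j)%N%:Z (Oaddr j) vb (N%:Z - 1)
          (3 * (code h)%:Z) m ((N * N)%N%:Z - N%:Z) acc fl0 bst0
          ((2 ^ j - 1) * N)%N%:Z (1 + N + j * (N * N))%N%:Z x0 (h j)%:Z cd0) hp
       (fun rs hp' => hp' = hp /\ exists j t acc fl bst x d cd, [/\
          rs = regs N%:Z n2 cnt t w R (2 ^ j)%N%:Z (Oaddr j) vb (N%:Z - 1)
            (3 * (code h)%:Z) m ((N * N)%N%:Z - N%:Z) acc fl bst
            ((2 ^ j - 1) * N)%N%:Z (1 + N + j * (N * N))%N%:Z x d cd,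
          (j + l.-1 = n')%N &
          (k.+1 <= N.-1)%N -> acc = partial_score j /\ chosen j fl bst]).
      apply: (@wp_if 17); first by []; run => hj.
        exact: wp_candidate.
      apply: wp_blk; first by []; run; apply: next => kN.
      by have [_ ch] := hval kN; apply: chosen_skip ch; lia.
    move=> ch; apply: wp_blk; first by []; run; rewrite Ec.
    have -> : (1 + N + j * (N * N))%N%:Z + ((2 ^ j - 1) * N)%N%:Z + k%:Z =
       (1 + N + j * (N * N) + (2 ^ j - 1) * N + k)%N%:Z by lia.
    split; first by heap.
    have -> : (1 + N + j * (N * N))%N%:Z + ((2 ^ j - 1) * N)%N%:Z + (N%:Z - 1) =
       (1 + N + j * (N * N) + (2 ^ j - 1) * N + N.-1)%N%:Z by lia.
    split; first by heap.
    split=> //; exists j.+1; do 7!eexists; split.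
    + rewrite -Ec /Oaddr expnS En; regs_eq.
      have PN : (N <= 2 ^ j * N)%N by rewrite leq_pmull.
      by rewrite !mulnBl; lia.
    + by lia.
    + move=> kN; split; last by exact: ch.
      have [-> _] := hval kN; rewrite /partial_score big_ord_recr /= !oI !inp_v //; try lia.
      by ring.
  have jn : j = n'.
    have : (n' <= j)%N; last by lia.
    by rewrite -(@leq_exp2l 2) // -/N; lia.
  apply: q0 => kN; have [_ [[_ h0]|[_ pb ub]]] := hval kN.
    (* Without any candidate all slot counts vanish, contradicting that [k.+1] players remain. *)
    have : mass h = wsum 2 n' (fun=> (0 * 1)%N).
      by apply: eq_wsum => i; rewrite -jn => /h0.
    by rewrite wsumM mh; lia.
  split=> // y /playS [h' [i [z [hi e pz ->]]]]; apply: ub pz => //.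
  by rewrite jn ltnNge; apply/negP => /sh; lia.
- split=> //; exists 0%N; do 7!eexists; split.
  + by rewrite expn0 /Oaddr; regs_eq.
  + by [].
  + move=> _; split; first by rewrite /partial_score big_ord0.
    by left.
Qed.

End Choose.

Lemma wp_table T hp Q n2 cnt t w pw po vb q acc fl bst u b x d cd :
  (repunit N n' * (44 * n' + 40) + 3 <= T)%N -> n2 = (N * N)%N%:Z ->
  offsets_ok n' hp -> (forall j, hp (Daddr j) = 0) -> (forall j, hp (Taddr j) = 0) ->
  (forall hp' cnt t pw po c m q acc fl bst u b x d cd, offsets_ok n' hp' ->
     best_play sc N.-1 (fun i => i < n')%N (hp' (Taddr (repunit N n'))) ->
     Q (regs N%:Z n2 cnt t w (3 * (repunit N n')%:Z) pw po vb (N%:Z - 1) c m q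
         acc fl bst u b x d cd) hp') ->
  wp table_cmd T (regs N%:Z n2 cnt t w (3 * (repunit N n')%:Z) pw po vb (N%:Z - 1)
    0 0 q acc fl bst u b x d cd) hp Q.
Proof.
move=> nT En oh dz tz q0.
apply: (@wp_while (fun l rs hp' => exists h cnt t pw po q acc fl bst u b x d cd, [/\
   rs = regs N%:Z n2 cnt t w (3 * (repunit N n')%:Z) pw po vb (N%:Z - 1)
    (3 * (code h)%:Z) (mass h)%:Z q acc fl bst u b x d cd,
   (code h + l = repunit N n')%N,
   supported h /\ (forall i, (i < n')%N -> (h i < N)%N),
   offsets_ok n' hp' /\ digits_ok h hp' &
   table_ok (code h).+1 hp']) (44 * n' + 28)%N (repunit N n')).
- by rewrite /=; lia.
- move=> l rs hp' [h [cnt' [t' [pw' [po' [q' [acc' [fl' [bst' [u' [b' [x' [d' [cd'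
    [-> cl [sh hN] [oh' dh] th]]]]]]]]]]]]]]]; run; split=> hh.
    exists l.-1; first by lia.
    apply: (@wp_seq 3 (44 * n' + 25)); first by lia.
    apply: wp_blk; first by []; run; rewrite addr0.
    apply: (@wp_seq (8 * n' + 3) (36 * n' + 22)); first by lia.
    apply: (@wp_carry _ h) => //; first by lia.
    move=> j hp1 q1 jn hj hjN oh1 dh1 th1.
    (* [h1] is the successor of [h] as a base-[N] counter. *)
    pose h1 := carry j h.
    have ch1 : code h1 = (code h).+1.
      by have := wsum_carry N jn hj; have := repunitE j N0; rewrite -/h1; lia.
    have mh1 : (mass h1)%:Z = (mass h)%:Z - (N%:Z - 1) * ((2 ^ j)%N%:Z - 1) + (2 ^ j)%N%:Z.
      have := wsum_carry 2 jn hj; rewrite -/h1 repunit2.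
      by have := expn_gt0 2 j; have := N0; nia.
    have sh1 : supported h1.
      by move=> i ni; rewrite /h1 /carry ltnNge (leq_trans (ltnW jn) ni) /= (sh i ni); lia.
    have hN1 i : (i < n')%N -> (h1 i < N)%N.
      move=> ii; rewrite /h1 /carry; case: (ltnP i j) => // ij.
      by have [->|_] := eqVneq i j; rewrite ?addn0 ?hN //; lia.
    apply: (@wp_seq 13 (36 * n' + 9)); first by lia.
    apply: wp_blk; first by []; run; split; first by rewrite /Daddr; heap.
    set hp2 := upd _ _ _.
    have oh2 : offsets_ok n' hp2.
      by apply: offsets_ok_upd => // i; rewrite /Daddr /Oaddr; lia.
    have dh2 : digits_ok h1 hp2.
      move=> i ii; rewrite /hp2; have [->|ij] := eqVneq i j.
        by rewrite upd_same /h1 /carry ltnn eqxx; lia.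
      rewrite upd_other ?dh1 //; last by rewrite /Daddr; lia.
      by rewrite /h1 /carry (negPf ij) addn0.
    have th2 : table_ok (code h1) hp2.
      move=> g sg mg; rewrite ch1 => cg; rewrite /hp2 upd_other; last first.
        by rewrite /Daddr /Taddr; lia.
      by rewrite th1; apply: th.
    have [k mk] : exists k, mass h1 = k.+1.
      have := @wsum_ge 2 n' h1 j erefl jn; rewrite {1}/h1 /carry ltnn eqxx.
      by have := expn_gt0 2 j; case: (mass h1) => [|k]; [nia|exists k].
    rewrite -mh1 En.
    have -> : 3 * (code h)%:Z + 3 = 3 * (code h1)%:Z by lia.
    have -> : (mass h1)%:Z - 1 = k%:Z by lia.
    apply: (@wp_seq (36 * n' + 3) 3); first by lia.
    apply: (@wp_choose h1 k) => //.
    move=> t3 pw3 po3 acc3 fl3 bst3 u3 b3 x3 d3 cd3 hb.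
    apply: wp_blk; first by []; run.
    have -> : -102 - 3 * (code h1)%:Z = Taddr (code h1) by rewrite /Taddr; lia.
    split; first by rewrite /Taddr; heap.
    exists h1; do 13!eexists; split.
    + by rewrite /regs.
    + by lia.
    + by [].
    + split; first by apply: offsets_ok_upd => // i; rewrite /Taddr /Oaddr; lia.
      by move=> i ii; rewrite upd_other ?dh2 //; rewrite /Taddr /Daddr; lia.
    + move=> g sg mg; rewrite ltnS leq_eqVlt => /orP[/eqP eg|cg].
        (* At most [N.-1] players forces every digit of [g] below [N], so equal codes mean equal
           states. *)
        have gN i : (i < n')%N -> (g i < N)%N.
          move=> ii; have := wsum_ge g (isT : 0 < 2)%N ii.
          by have := expn_gt0 2 i; have := N0; nia.
        have gh : g =1 h1.
          move=> i; case: (ltnP i n') => ii; last by rewrite sg // sh1.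
          exact: wsum_inj gN hN1 eg _ ii.
        have mgh : mass g = k.+1 by rewrite -mk; apply: eq_wsum => i _.
        rewrite eg upd_same mgh; rewrite mgh in mg.
        have [pb ub] := hb mg; split; first by apply: play_ext pb => i; rewrite gh.
        by move=> y py; apply: ub; apply: play_ext py.
      rewrite upd_other; last by rewrite /Taddr; lia.
      exact: th2.
  apply: q0 => //.
  have mo : mass (fun i => (i < n')%N) = N.-1 by rewrite wsum_ltn // repunit2 subn1.
  have co : code (fun i => (i < n')%N) = repunit N n' by rewrite wsum_ltn.
  rewrite -[X in best_play _ X]mo -co; apply: th; rewrite ?mo ?co //; last by lia.
  by move=> i ni; rewrite ltnNge ni.
- have z W : wsum W n' (fun=> 0%N) = 0%N by rewrite /wsum big1.
  exists (fun=> 0%N); do 13!eexists; split.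
  + by rewrite !z; regs_eq.
  + by rewrite z.
  + by split.
  + by split=> // i _; apply: dz.
  + move=> g sg mg; rewrite z => c0.
    (* Initially only code 0 must be correct: it is the empty state, whose sole play has value 0, as
       stored. *)
    have g0 i : g i = 0%N.
      case: (ltnP i n') => ii; last exact: sg.
      have := wsum_ge g N0 ii; have : (0 < N ^ i)%N by rewrite expn_gt0 N0.
      by nia.
    have -> : mass g = 0%N by rewrite -[RHS](z 2%N); apply: eq_wsum => i _.
    rewrite tz; split; first exact: PlayDone.
    by move=> y; move E: 0%N => k1 py; case: k1 g y / py E {sg mg c0 g0}.
Qed.

Lemma wp_main T Q :
  (n' * (5 * N + 20) + repunit N n' * (44 * n' + 40) + 5 * N + 30 <= T)%N ->
  (forall rs hp, (exists2 x, best_play sc N.-1 (fun i => i < n')%N x &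
      hp 0 = if V <= x then 1 else 0) -> Q rs hp) ->
  wp main_cmd T (nseq nregs 0) heap0 Q.
Proof.
move=> nT q0.
apply: (@wp_seq 5 (n' * (5 * N + 20) + repunit N n' * (44 * n' + 40) + 5 * N + 25)); first by lia.
apply: wp_blk; first by []; cbn [nseq nregs ncons iter]; run.
split=> //.
have -> : heap0 0 = N%:Z by exact: inp0.
rewrite addr0.
apply: (@wp_seq (5 * N + 3) (n' * (5 * N + 20) + repunit N n' * (44 * n' + 40) + 22)); first by lia.
apply: wp_mul; first by lia.
apply: (@wp_seq 5 (n' * (5 * N + 20) + repunit N n' * (44 * n' + 40) + 17)); first by lia.
apply: wp_blk; first by []; run; rewrite addr0.
apply: (@wp_seq (n' * (5 * N + 20) + 3) (repunit N n' * (44 * n' + 40) + 14)); first by lia.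
apply: wp_setup; [by lia|by rewrite PoszM|by []|by []|].
move=> hp t x cnt w pw po oh dz tz.
apply: (@wp_seq (repunit N n' * (44 * n' + 40) + 3) 11); first by lia.
apply: wp_table; [by lia|by rewrite PoszM|by []|by []|by []|].
move=> hp' cnt' t' pw' po' c m q acc fl bst u b x' d cd [oI oO] bp.
apply: (@wp_seq 4 4); first by [].
apply: wp_blk; first by []; run; split; first by heap.
have -> : -102 - 3 * (repunit N n')%:Z = Taddr (repunit N n') by rewrite /Taddr; lia.
split; first by rewrite /Taddr; heap.
rewrite oI inp_V.
apply: (@wp_if 1); first by []; run => hV; apply: wp_blk; first by []; run; split=> //.
all: by apply: q0; exists (hp' (Taddr (repunit N n'))) => //; rewrite upd_same ?hV // leNgt hV.
Qed.

End Table.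

(** With [n' < N] the four summands are at most 25, 84, 5 and 30 times the power on the right, and
    these add up to 144. *)
Lemma time_bound n' (N := (2 ^ n')%N) :
  (n' * (5 * N + 20) + repunit N n' * (44 * n' + 40) + 5 * N + 30
     <= 144 * N ^ (144 * n'.+1))%N.
Proof.
have N0 : (0 < N)%N by rewrite expn_gt0.
have nN : (n' < N)%N by rewrite ltn_expl.
have RN : (repunit N n' <= N ^ n')%N.
  have [n0|n0] := posnP n'; first by rewrite n0 /wsum big_ord0.
  by have := repunitE n' N0; nia.
have e1 : (N * N <= N ^ (144 * n'.+1))%N.
  by rewrite mulnn leq_pexp2l //; lia.
have e2 : (N ^ n' * N <= N ^ (144 * n'.+1))%N by rewrite -expnSr leq_pexp2l //; lia.
set E := (N ^ _)%N in e1 e2 *; set A := (N ^ n')%N in RN e2.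
have h1 : (n' * (5 * N + 20) <= 25 * (N * N))%N by nia.
have h2 : (repunit N n' * (44 * n' + 40) <= A * (84 * N))%N by apply: leq_mul => //; nia.
by nia.
Qed.

(* There is a single RAM program deciding Tournament Value Maximization on
   all instances with a win-count oriented game-value function, within
   c * n^(c * (log2 n + 1)) = n^O(log n) steps, where n = |N| = 2^n'.
   Answer: cell 0 equals 1 on halting iff the instance is a yes-instance. *)
Theorem theorem6 :
  exists (P : program) (c : nat),
    forall (n' : nat) (s : seq nat) (v : nat -> nat -> nat -> int) (V : int),
      sorted ltn s -> size s = (2 ^ n')%N ->
      win_count_oriented n' s v ->
      exists k : nat,
        (k <= c * (2 ^ n') ^ (c * n'.+1))%N /\
        halted P (exec P k (init_config n' s v V)) /\
        (cmem (exec P k (init_config n' s v V)) 0 = 1 <-> TVM_yes n' s v V).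
Proof.
exists (compile 0 main_cmd), 144%N => n' s v V ss szs wco.
have inp0 := input_size n' s v V; rewrite szs in inp0.
have inp_v := @input_value n' s v V; rewrite szs in inp_v.
have inp_V := input_threshold n' s v V; rewrite szs in inp_V.
have code0 : code_at (compile 0 main_cmd) 0 (compile 0 main_cmd) by [].
have rep0 : represents (nseq nregs 0) (heap0 (nth 0 (input_list n' s v V)))
    (cmem (init_config n' s v V)).
  by split=> // i ii; rewrite nth_nseq ii.
have [k [m [rs [hp [kT ek [_ _ hm] [x [px ux] hp0]]]]]] :=
  wp_main inp0 inp_v inp_V (time_bound n') (fun rs hp h => h) isT code0 rep0.
exists k; split=> //; rewrite ek; split.
  (* The program stops by running past its last instruction, where [nth] returns the default
     [IHalt]. *)
  by rewrite /halted nth_default // size_compile.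
rewrite /= hm // hp0 (TVM_play V ss szs wco); split=> [|[y [Vy py]]].
  by case: ifP => // Vx _; exists x.
by rewrite (le_trans Vy (ux _ py)).
Qed.
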